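(* Let $T \colon X \to X$ be a biLipschitz homeomorphism of a compact metric space. Suppose that $T$ has a compact invariant set $\Lambda$ containing more than one point and such that the restriction $T|_\Lambda$ is topologically conjugate to a mixing (two-sided) subshift of finite type. Fix a constant $\lambda_0>0$. Then there exists a continuous map $A \colon X \to \mathrm{SL}^{\pm}(2,\mathbb{R})$ such that (i) $\lambda(T,A,\mu) = \lambda_0$ for every $T$-invariant ergodic Borel probability measure $\mu$ on $X$, and (ii) the cocycle $(T,A)$ is not uniformly hyperbolic.
   Context: $\mathrm{SL}^{\pm}(2,\mathbb{R})$ is the group of real $2\times 2$ matrices with determinant $\pm 1$. If $T\colon X\to X$ is a homeomorphism of a compact metric space and $A\colon X\to \mathrm{SL}^{\pm}(2,\mathbb{R})$ is continuous, the pair $(T,A)$ is called a cocycle, and $A^{(n)}(x)$ ($x \in X$, $n\in\mathbb{Z}$) is the unique family of matrices with $A^{(1)}(x)=A(x)$ and $A^{(m+n)}(x)=A^{(m)}(T^n x)A^{(n)}(x)$ for all $m,n \in \mathbb{Z}$. If $\mu$ is a $T$-invariant ergodic Borel probability measure, the (top) Lyapunov exponent $\lambda(T,A,\mu)\ge 0$ is the number such that $\lim_{n\to+\infty}\frac1n\log\|A^{(n)}(x)\|=\lambda(T,A,\mu)$ for $\mu$-almost every $x$. The cocycle $(T,A)$ is uniformly hyperbolic if $\liminf_{n\to\pm\infty}\inf_{x\in X}\frac{1}{|n|}\log\|A^{(n)}(x)\|>0$. *)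

(* Defs.v *)
From HB Require Import structures.
From mathcomp Require Import all_boot all_order all_algebra.
From mathcomp Require Import all_classical all_reals all_analysis.

Set Implicit Arguments.
Unset Strict Implicit.
Unset Printing Implicit Defensive.
Import Order.TTheory GRing.Theory Num.Theory.
Import numFieldNormedType.Exports.
Local Open Scope classical_set_scope.
Local Open Scope ring_scope.

(** The library only puts measurable structures on pointed types; for a
    metric space that has at least one point the base point is no restriction. *)
#[short(type="pmetricType")]
HB.structure Definition PointedMetric (K : numDomainType) :=
  {M of Pointed M & Metric K M}.

Section TopologicalDynamics.

Definition homeomorphism (U V : topologicalType) (f : U -> V) (g : V -> U) :=
  [/\ cancel f g, cancel g f, continuous f & continuous g].

Definition bilipschitz (R : realType) (X : metricType R) (f : X -> X) :=
  exists2 k : R, 0 < k &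
    forall x y, k^-1 * mdist x y <= mdist (f x) (f y) <= k * mdist x y.

(** [f] restricted to the invariant set [K] is topologically mixing for the
    relative topology of [K], whose open sets are the [K `&` U], [U] open. *)
Definition topologically_mixing (U : topologicalType) (K : set U)
    (f : U -> U) :=
  forall V W : set U, open V -> open W ->
    K `&` V !=set0 -> K `&` W !=set0 ->
    exists N : nat, forall n, (N <= n)%N ->
      (K `&` V) `&` iter n f @^-1` (K `&` W) !=set0.

(** [h] and [k] are total functions of which only the restrictions to [K] and
    [L] matter: these are mutually inverse homeomorphisms between [K] and [L]. *)
Record conjugacy (U V : topologicalType) (K : set U) (f : U -> U)
    (L : set V) (g : V -> V) (h : U -> V) (k : V -> U) : Prop := Conjugacy {
  conjugacy_fun : forall x, K x -> L (h x);
  conjugacy_inv : forall y, L y -> K (k y);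
  conjugacy_funK : forall x, K x -> k (h x) = x;
  conjugacy_invK : forall y, L y -> h (k y) = y;
  conjugacy_fun_continuous : {within K, continuous h};
  conjugacy_inv_continuous : {within L, continuous k};
  conjugacy_comm : forall x, K x -> h (f x) = g (h x) }.

Definition topologically_conjugate (U V : topologicalType)
    (K : set U) (f : U -> U) (L : set V) (g : V -> V) :=
  exists h k, conjugacy K f L g h k.

End TopologicalDynamics.

Notation biseq S := (prod_topology (fun _ : int => discrete_topology S)).

Definition left_shift (S : finType) (x : biseq S) : biseq S := fun i => x (i + 1).

(** The word [x_i x_(i+1) ... x_(i+n-1)]. *)
Definition window (S : finType) (x : biseq S) (i : int) (n : nat) : seq S :=
  [seq (x (i + j%:Z) : S) | j <- iota 0 n].

(** The two-sided subshift of finite type whose forbidden words are the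
    members of the finite list [F]. *)
Definition sft (S : finType) (F : seq (seq S)) : set (biseq S) :=
  [set x | forall w i, w \in F -> window x i (size w) <> w].

Definition conjugate_to_mixing_sft (X : topologicalType) (T : X -> X)
    (L : set X) :=
  exists (S : finType) (F : seq (seq S)),
    topologically_mixing (sft F) (@left_shift S) /\
    topologically_conjugate (sft F) (@left_shift S) L T.

Section Norms.
Variable R : realType.

Definition SLpm : set 'M[R]_2 := [set M | \det M = 1 \/ \det M = -1].

Definition enorm (v : 'cV[R]_2) : R := Num.sqrt (\sum_i v i 0 ^+ 2).

(** Operator norm for the Euclidean norm (the norm of ['M_2] in the library is
    the largest absolute value of an entry). *)
Definition opnorm (M : 'M[R]_2) : R :=
  sup [set enorm (M *m v) | v in [set v | enorm v = 1]].

End Norms.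

Section Cocycles.
Variables (R : realType) (X : Type).
Implicit Types (T Tinv : X -> X) (A : X -> 'M[R]_2) (x : X).

(** [T^n x], where [Tinv] is the inverse of [T]; [Negz n] is [- (n + 1)]. *)
Definition ziter T Tinv (n : int) x : X :=
  match n with
  | Posz m => iter m T x
  | Negz m => iter m.+1 Tinv x
  end.

Fixpoint cocycle_nat T A (n : nat) x : 'M[R]_2 :=
  if n is m.+1 then A (iter m T x) *m cocycle_nat T A m x else 1%:M.

(** [A^(n)(x)], characterized by [cocycle1], [cocycleD], [cocycle_unique]. *)
Definition cocycle T Tinv A (n : int) x : 'M[R]_2 :=
  match n with
  | Posz m => cocycle_nat T A m x
  | Negz m => invmx (cocycle_nat T A m.+1 (iter m.+1 Tinv x))
  end.

Let NegzS1 n : Negz n.+1 + 1 = Negz n.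
Proof. by rewrite !NegzE -[n.+2]addn1 PoszD opprD addrNK. Qed.

Let int_step_ind (P : int -> Prop) :
  P 0 -> (forall n, P n <-> P (n + 1)) -> forall n, P n.
Proof.
move=> P0 PS; case; first by elim=> // n /PS; rewrite -PoszD addn1.
by elim=> [|n IH]; apply/PS; rewrite ?NegzS1.
Qed.

Lemma ziterS T Tinv n x : cancel Tinv T ->
  ziter T Tinv (n + 1) x = T (ziter T Tinv n x).
Proof.
move=> TK; case: n => [n|[|n]]; first by rewrite -PoszD addn1.
  by rewrite /= TK.
by rewrite NegzS1 [in RHS]/= TK.
Qed.

Lemma ziterD T Tinv m n x : cancel T Tinv -> cancel Tinv T ->
  ziter T Tinv (m + n) x = ziter T Tinv m (ziter T Tinv n x).
Proof.
move=> TK KT; elim/int_step_ind: m => [|m]; first by rewrite add0r.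
by rewrite addrAC !ziterS//; split=> [->//|/(can_inj TK)].
Qed.

Lemma cocycle1 T Tinv A x : cocycle T Tinv A 1 x = A x.
Proof. by rewrite /= mulmx1. Qed.

Lemma cocycleS T Tinv A n x : cancel Tinv T -> (forall y, A y \in unitmx) ->
  cocycle T Tinv A (n + 1) x = A (ziter T Tinv n x) *m cocycle T Tinv A n x.
Proof.
move=> KT Au.
have cu m y : cocycle_nat T A m y \in unitmx.
  by elim: m => [|m IH] /=; rewrite ?unitmx1// unitmx_mul Au IH.
have cS m y : cocycle_nat T A m.+1 y = cocycle_nat T A m (T y) *m A y.
  elim: m => [|m IH]; first by rewrite /= mulmx1 mul1mx.
  by rewrite [LHS]/= -/(cocycle_nat T A m.+1 y) IH mulmxA -iterS iterSr.
have invM (B C : 'M[R]_2) : B \in unitmx -> C \in unitmx ->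
  invmx (B *m C) = invmx C *m invmx B by exact: invrM.
case: n => [n|n]; first by rewrite -PoszD addn1.
transitivity (invmx (cocycle_nat T A n (iter n Tinv x))); last first.
  by rewrite /cocycle cS invM// [in T _]iterS KT mulmxA mulmxV// mul1mx.
by case: n => [|n]; rewrite ?NegzS1//= invmx1.
Qed.

Lemma cocycleD T Tinv A m n x : cancel T Tinv -> cancel Tinv T ->
  (forall y, A y \in unitmx) ->
  cocycle T Tinv A (m + n) x =
  cocycle T Tinv A m (ziter T Tinv n x) *m cocycle T Tinv A n x.
Proof.
move=> TK KT Au; elim/int_step_ind: m => [|m]; first by rewrite add0r mul1mx.
rewrite addrAC !cocycleS// ziterD// -mulmxA; split=> [->//|].
by move/(can_inj (mulKmx (Au _))).
Qed.

Lemma cocycle_unique T Tinv A (C : int -> X -> 'M[R]_2) :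
  cancel T Tinv -> cancel Tinv T -> (forall y, A y \in unitmx) ->
  (forall x, C 1 x = A x) ->
  (forall m n x, C (m + n) x = C m (ziter T Tinv n x) *m C n x) ->
  forall n x, C n x = cocycle T Tinv A n x.
Proof.
move=> TK KT Au C1 CD n x; elim/int_step_ind: n => [|n].
  apply: (can_inj (mulKmx (Au x))); rewrite mulmx1 -{1}C1.
  by rewrite -(CD 1 0 x) addr0 C1.
rewrite [n + 1]addrC CD C1 [1 + n]addrC cocycleS//; split=> [->//|].
by move/(can_inj (mulKmx (Au _))).
Qed.

(** [1/|n| * log ||A^(n)(x)||]; at [n = 0] the value is [0]. *)
Definition growth T Tinv A (n : int) x : R :=
  (`|n|%N%:R)^-1 * ln (opnorm (cocycle T Tinv A n x)).

Local Open Scope ereal_scope.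

(** The liminf as [n] tends to [+oo] and [-oo] is the smaller of the liminfs
    along the two ends of the integers. *)
Definition uniformly_hyperbolic T Tinv A :=
  0 < limn_einf (fun n : nat =>
        ereal_inf [set (growth T Tinv A n%:Z x)%:E | x in setT]) /\
  0 < limn_einf (fun n : nat =>
        ereal_inf [set (growth T Tinv A (- n%:Z) x)%:E | x in setT]).

End Cocycles.

Notation borel X := (g_sigma_algebraType (@open X)).

Section Measures.
Local Open Scope ereal_scope.
Variables (R : realType) (X : ptopologicalType).
Implicit Types (mu : probability (borel X) R) (T Tinv : X -> X).

Definition invariant_measure T mu :=
  forall B : set (borel X), measurable B -> mu (T @^-1` B) = mu B.

Definition ergodic T mu :=
  forall B : set (borel X), measurable B -> T @^-1` B = B ->
    mu B = 0 \/ mu B = 1.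

(** [lambda(T, A, mu) = l]; on a space of positive measure [l] is unique. *)
Definition has_lyapunov_exponent T Tinv (A : X -> 'M[R]_2) mu (l : R) :=
  \forall x \ae mu, growth T Tinv A n%:Z x @[n --> \oo] --> l.

End Measures.

(* Main.v *)
Require Import Defs.
From HB Require Import structures.
From mathcomp Require Import all_boot all_order all_algebra.
From mathcomp Require Import all_classical all_reals all_analysis.
From mathcomp Require Import zify lra ring.

Set Implicit Arguments.
Unset Strict Implicit.
Unset Printing Implicit Defensive.
Import Order.TTheory GRing.Theory Num.Theory.
Import numFieldNormedType.Exports.
Local Open Scope classical_set_scope.
Local Open Scope ring_scope.

(** Let [e = exp lambda0] and [D = diag(e, 1/e)], and let [y] be a point that
    is isolated in its own orbit: a point homoclinic to a periodic orbit of the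
    subshift.  Off the orbit of [y] the cocycle is [A x = B(T x) D B(x)^-1],
    where [B] is the identity except in a thin neighbourhood of the orbit of
    [y].  As [x] tends to that orbit, [B] degenerates, but so gradually in time
    that [A] extends continuously, and along the orbit itself the expanding and
    the contracting direction are exchanged: [A^(2n+1)(T^-n y)] is bounded in
    [n], which excludes uniform hyperbolicity.

    Closeness to [y] is measured by [t z], of order [(log 1/d(y,z))^(-1/2)], and
    [B] has norm at most [1/t].  As [T] is biLipschitz, [T^j z] can be close to
    [y] only if [j] is of order at least [1/(t z)^2].  Hence the first [n^2]
    preimages of [{t < 1/n}] are disjoint, its measure is at most [1/n^2], and
    by Borel-Cantelli [B] grows at most linearly along almost every orbit: the
    exponent of [A] is that of [D]. *)

(** * Homoclinic points of subshifts of finite type *)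

Section SubshiftOfFiniteType.
Variables (S : finType) (F : seq (seq S)).
Implicit Types (x z p q : biseq S) (i j c : int).

Let memory := (\max_(w <- F) size w)%N.

Lemma eq_window x z i j n :
  (forall e : nat, (e < n)%N -> x (i + e%:Z) = z (j + e%:Z)) ->
  window x i n = window z j n.
Proof.
move=> xz; apply/eq_in_map => e; rewrite mem_iota add0n => /andP[_ en].
exact: xz.
Qed.

Lemma sft_local x :
  (forall i, exists2 z, sft F z & exists j, forall e : nat,
    (e < memory)%N -> x (i + e%:Z) = z (j + e%:Z)) ->
  sft F x.
Proof.
move=> xloc w i wF; have [z zF [j xz]] := xloc i.
rewrite (@eq_window x z i j); first exact: zF.
move=> e ew; apply: xz; apply: leq_trans ew _.
by rewrite /memory (big_rem w)//= leq_maxl.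
Qed.

Definition shift_by j x : biseq S := fun i => x (i + j).

Lemma sft_shift j x : sft F x -> sft F (shift_by j x).
Proof.
move=> xF; apply: sft_local => i; exists x => //; exists (i + j) => e _.
by rewrite /shift_by addrAC.
Qed.

Definition glue c x z : biseq S := fun i => if i < c then x i else z i.

Lemma glueL c x z i : i < c -> glue c x z i = x i.
Proof. by rewrite /glue => ->. Qed.

Lemma glueR c x z i : c <= i -> glue c x z i = z i.
Proof. by rewrite /glue ltNge => ->. Qed.

(** A window starting at or after [c] is read off [z]. One starting before [c] is read off [x],
    because what it covers beyond [c] lies in the overlap where the two points agree. *)
Lemma sft_glue c x z : sft F x -> sft F z ->
  (forall e : nat, (e < memory)%N -> x (c + e%:Z) = z (c + e%:Z)) ->
  sft F (glue c x z).
Proof.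
move=> xF zF xz; apply: sft_local => i.
have [ci|ic] := leP c i.
  exists z => //; exists i => e _.
  by rewrite glueR//; lia.
exists x => //; exists i => e em.
have [h|h] := ltP (i + e%:Z) c; first by rewrite glueL.
rewrite glueR//.
have -> : i + e%:Z = c + (`|(i + e%:Z - c)%R|%N)%:Z by lia.
by rewrite xz//; lia.
Qed.

(** Pigeonhole: some word of length [memory] occurs in [x] at two times [a < b], and the block
    between them can be repeated forever. *)
Lemma sft_periodic x : sft F x ->
  exists2 p, sft F p & exists2 P : nat, (0 < P)%N &
    forall i, p (i + P%:Z) = p i.
Proof.
move=> xF.
pose word (k : 'I_#|{ffun 'I_memory -> S}|.+1) : {ffun 'I_memory -> S} :=
  [ffun e => x (k%:Z + (val e)%:Z)].
have /injectivePn[a [b ab wab]] : ~~ injectiveb word.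
  apply/negP => /injectiveP/leq_card; by rewrite card_ord ltnn.
wlog ltab : a b ab wab / (a < b)%N.
  move=> wl; have [|ba|/val_inj eab] := ltngtP a b; first exact: wl.
    by apply: (wl b a) => //; rewrite eq_sym.
  by rewrite eab eqxx in ab.
pose P := (b - a)%N; have P0 : (0 < P)%N by rewrite subn_gt0.
have PE : (b%:Z = a%:Z + P%:Z) by rewrite /P; lia.
have xP (e : nat) : (e < memory)%N -> x (a%:Z + e%:Z + P%:Z) = x (a%:Z + e%:Z).
  move=> em; have /ffunP/(_ (Ordinal em)) := wab; rewrite !ffunE/= => ->.
  by rewrite PE addrAC.
(* The stretch of length [memory + P] from [a] is [P]-periodic, so it contains every window of
   length [memory] of the repeated block. *)
have xmod (k : nat) : (k < memory + P)%N ->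
    x (a%:Z + k%:Z) = x (a%:Z + (k %% P)%N%:Z).
  elim/ltn_ind: k => k IH kmP.
  have [kP|Pk] := ltnP k P; first by rewrite modn_small.
  have -> : (a%:Z + k%:Z = a%:Z + (k - P)%N%:Z + P%:Z) by lia.
  rewrite xP; last by lia.
  rewrite IH; [|lia|lia].
  by rewrite -[in RHS](subnK Pk) modnDr.
pose p : biseq S := fun i => x (a%:Z + (i %% P%:Z)%Z).
exists p; last first.
  by exists P => // i; rewrite /p modzDr.
apply: sft_local => i; exists x => //; exists (a%:Z + (i %% P%:Z)%Z) => e em.
have i0 : 0 <= (i %% P%:Z)%Z by apply: modz_ge0; lia.
have iP : (i %% P%:Z)%Z < P%:Z by apply: ltz_pmod; lia.
rewrite -addrA; move: i0 iP; case E : (i %% P%:Z)%Z => [k|//] _ kP.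
rewrite -PoszD xmod; last by lia.
by rewrite /p -modz_nat PoszD -E modzDml.
Qed.

Lemma iter_left_shift n x : iter n (@left_shift S) x = shift_by n%:Z x.
Proof.
elim: n => [|n IH]; first by apply/funext => i; rewrite /shift_by addr0.
rewrite iterS IH; apply/funext => i; rewrite /left_shift /shift_by.
by congr (x _); lia.
Qed.

Definition cylinder (N : nat) q : set (biseq S) :=
  [set x | forall e : int, `|e| <= N%:Z -> x e = q e].

Lemma open_coord (s : S) i : open [set x : biseq S | x i = s].
Proof.
have -> : [set x : biseq S | x i = s] =
    proj i @^-1` [set (s : discrete_topology S)].
  by apply/seteqP; split.
apply: open_comp; last exact: discrete_open.
by move=> x _; exact: proj_continuous.
Qed.

Lemma open_cylinder N q : open (cylinder N q).
Proof.
elim: N => [|N IH].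
  rewrite (_ : cylinder 0 q = [set x : biseq S | x 0 = q 0]).
    exact: open_coord.
  apply/seteqP; split => x /=; first by apply.
  by move=> x0 e e0; have -> : e = 0 by lia.
rewrite (_ : cylinder N.+1 q = cylinder N q `&`
   ([set x : biseq S | x N.+1%:Z = q N.+1%:Z] `&`
    [set x : biseq S | x (- N.+1%:Z) = q (- N.+1%:Z)])); last first.
  apply/seteqP; split => x /=.
    move=> xq; split; first by move=> e eN; apply: xq; lia.
    by split; apply: xq; lia.
  move=> [xq [xr xl]] e eN.
  have [eN'|eN'] := leP `|e| N%:Z; first exact: xq.
  have [->//|-> //] : e = N.+1%:Z \/ e = - N.+1%:Z by lia.
by do 2?apply: openI => //; exact: open_coord.
Qed.

(* If every point had period [P], mixing would return a point of the cylinder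
   [x c = a c] to itself and also to [x c = b c] at the same time [n], a large
   multiple of [P]. *)
Lemma mixing_aperiodic (P : nat) a b : (0 < P)%N ->
  topologically_mixing (sft F) (@left_shift S) ->
  sft F a -> sft F b -> a <> b ->
  exists2 q, sft F q & exists i, q (i + P%:Z) <> q i.
Proof.
move=> P0 mix aF bF ab; apply: contrapT => per.
have perP x : sft F x -> forall i, x (i + P%:Z) = x i.
  by move=> xF i; apply: contrapT => xi; apply: per; exists x => //; exists i.
have [c abc] : exists c, a c <> b c.
  by apply: contrapT => abc; apply: ab; apply/funext => c; apply: contrapT => h;
     apply: abc; exists c.
have [] := mix [set x : biseq S | x c = a c] [set x : biseq S | x c = b c].
- exact: open_coord.
- exact: open_coord.
- by exists a.
- by exists b.
move=> N /(_ (N * P)%N); rewrite leq_pmulr// => /(_ isT).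
move=> [x [[xF xa] [_ /= xb]]].
apply: abc; rewrite -xa -xb iter_left_shift /shift_by.
elim: {xb} N => [|N IH]; first by rewrite mul0n addr0.
by rewrite mulSn PoszD (addrC P%:Z) addrA perP.
Qed.

(** The point [w] follows the periodic point [p], shows in a bounded zone a word of [q] that does
    not occur in [p], then follows [p] again. If shifting by [j] preserved the central window of
    [w], it would carry this word, by repeated moves of length [j], out of the zone unless
    [j = 0]. *)
Lemma homoclinic_point :
  topologically_mixing (sft F) (@left_shift S) ->
  (exists a b, [/\ sft F a, sft F b & a <> b]) ->
  exists2 w, sft F w & exists K, forall j,
    (forall e : int, `|e| <= K%:Z -> w (e + j) = w e) -> j = 0.
Proof.
move=> mix [a [b [aF bF ab]]].
have [p pF [P P0 pP]] := sft_periodic aF.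
have [q qF [k qk]] := mixing_aperiodic P0 mix aF bF ab.
(* The window of radius [m] sees both [k] and [k + P], where [q] breaks the period [P]; hence this
   word of [q] cannot occur in [p]. *)
have [m [mm mk mP]] : exists m : nat, [/\ (memory <= m)%N, `|k| <= m%:Z &
    `|k + P%:Z| <= m%:Z].
  by exists (memory + `|k|%N + P)%N; split; lia.
have nopq j : ~ (forall e : int, `|e| <= m%:Z -> p (j + e) = q e).
  by move=> h; apply: qk; rewrite -!h// addrA pP.
have opC := @open_cylinder m.
have [||N1 M1] := mix (cylinder m p) (cylinder m q) (opC p) (opC q).
- by exists p.
- by exists q.
have [||N2 M2] := mix (cylinder m q) (cylinder m p) (opC q) (opC p).
- by exists q.
- by exists p.
(* The margins [3 * m] keep the seams at [0], [n1 - m] and [n1 + n2] apart, so that each overlap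
   avoids the other seams and the word of [q] around [n1] survives. *)
pose n1 := (N1 + 3 * m + 1)%N; pose n2 := (N2 + 3 * m + 1)%N.
have [x1 [[x1F x1p] [_ x1q]]] := M1 n1 ltac:(rewrite /n1; lia).
have [x2 [[x2F x2q] [_ x2p]]] := M2 n2 ltac:(rewrite /n2; lia).
move: x1q x2p; rewrite !iter_left_shift /= => x1q x2p.
pose y2 := shift_by (- n1%:Z) x2; pose y3 := shift_by (- (n1 + n2)%N%:Z) p.
have y2F : sft F y2 by exact: sft_shift.
have y3F : sft F y3 by exact: sft_shift.
pose w1 := glue 0 p x1.
pose w2 := glue (n1%:Z - m%:Z) w1 y2.
pose w := glue (n1 + n2)%N%:Z w2 y3.
have w1F : sft F w1.
  by apply: sft_glue => // e em; rewrite x1p//; lia.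
have w2F : sft F w2.
  apply: sft_glue => // e em; rewrite /w1 glueR; last by rewrite /n1; lia.
  rewrite /y2 /shift_by.
  have -> : n1%:Z - m%:Z + e%:Z - n1%:Z = e%:Z - m%:Z by lia.
  rewrite x2q; last by lia.
  by rewrite -x1q /shift_by; [congr (x1 _); lia|lia].
have wF : sft F w.
  apply: sft_glue => // e em; rewrite /w2 glueR; last by lia.
  rewrite /y2 /y3 /shift_by.
  have -> : (n1 + n2)%N%:Z + e%:Z - (n1 + n2)%N%:Z = e%:Z by lia.
  rewrite -x2p; last by lia.
  by rewrite /shift_by; congr (x2 _); lia.
have wL i : i < 0 -> w i = p i.
  by move=> i0; rewrite /w glueL ?/w2 ?glueL ?/w1 ?glueL// /n1; lia.
have wR i : (n1 + n2)%N%:Z <= i -> w i = p (i - (n1 + n2)%N%:Z).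
  by move=> i0; rewrite /w glueR.
have wq e : `|e| <= m%:Z -> w (n1%:Z + e) = q e.
  move=> em; rewrite /w glueL; last by rewrite /n2; lia.
  rewrite /w2 glueR; last by lia.
  by rewrite /y2 /shift_by -x2q//; congr (x2 _); lia.
pose occ i := forall e : int, `|e| <= m%:Z -> w (i + e) = q e.
pose K := (n1 + n2 + 3 * m + 1)%N.
have occK i : occ i -> `|i| <= K%:Z - m%:Z.
  move=> oi; rewrite leNgt; apply/negP => iK.
  have [ipos|ineg] := leP 0 i.
    apply: (nopq (i - (n1 + n2)%N%:Z)) => e em.
    rewrite -(oi e em) wR; last by lia.
    by congr (p _); lia.
  by apply: (nopq i) => e em; rewrite -(oi e em) wL//; lia.
exists w => //; exists K => j wj.
have occj (l : nat) : occ (n1%:Z + l%:Z * j).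
  elim: l => [|l IH]; first by rewrite mul0r addr0.
  (* An occurrence is centred within [K - m] of the origin, so all its letters lie in the window
     that the shift by [j] preserves. *)
  move=> e em; rewrite -(IH e em) -(wj (n1%:Z + l%:Z * j + e)).
    by congr (w _); lia.
  by have := occK _ IH; lia.
have := occK _ (occj (2 * K + n1)%N); nia.
Qed.

End SubshiftOfFiniteType.

(** * A gauge of the return times to a nonrecurrent point *)

(** The homoclinic point is isolated in its orbit by a cylinder; continuity of the inverse conjugacy
    at its image turns the cylinder into a ball of radius [c]. *)
Lemma nonrecurrent_point (R : realType) (X : metricType R) (T Tinv : X -> X)
    (L : set X) :
  cancel T Tinv -> cancel Tinv T ->
  (exists x y, [/\ L x, L y & x <> y]) -> conjugate_to_mixing_sft T L ->
  exists y, exists2 c : R, 0 < c &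
    forall j, j <> 0 -> c <= mdist y (ziter T Tinv j y).
Proof.
move=> TK KT [a [b [La Lb ab]]] [S [F [mix [h [k hk]]]]].
have [|w wF [K wK]] := homoclinic_point mix.
  exists (k a), (k b); split; [exact: (conjugacy_inv hk)..|].
  by move=> /(congr1 h); rewrite !(conjugacy_invK hk).
have orb j : ziter T Tinv j (h w) = h (shift_by j w).
  have hT x : sft F x -> T (h x) = h (shift_by 1 x).
    by move=> xF; rewrite -(conjugacy_comm hk xF).
  case: j => n; elim: n => [|n IH].
  - by congr h; apply/funext => i; rewrite /shift_by addr0.
  - rewrite [LHS]/= [iter _ _ _]IH hT; last exact: sft_shift.
    by congr h; apply/funext => i; rewrite /shift_by; congr (w _); lia.
  - apply: (can_inj TK); rewrite /= KT hT; last exact: sft_shift.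
    by congr h; apply/funext => i; rewrite /shift_by; congr (w _); lia.
  - rewrite [LHS]/= -[Tinv (iter _ _ _)]/(ziter T Tinv (Negz n) (h w)) IH.
    apply: (can_inj TK); rewrite KT hT; last exact: sft_shift.
    by congr h; apply/funext => i; rewrite /shift_by; congr (w _); lia.
have Lw : L (h w) by exact: (conjugacy_fun hk).
have /subspace_continuousP/(_ _ Lw) kc := conjugacy_inv_continuous hk.
have /kc : nbhs (k (h w)) (cylinder K w).
  apply: open_nbhs_nbhs; split; first exact: open_cylinder.
  by rewrite (conjugacy_funK hk).
rewrite /= => /metricType_numDomainType.nbhs_mdistP[c /= c0 cP].
exists (h w), c => // j j0; rewrite leNgt; apply/negP => djc.
apply: j0; apply: wK => e eK.
have jF : sft F (shift_by j w) by exact: sft_shift.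
have := cP _ djc; rewrite orb => /(_ (conjugacy_fun hk jF)).
by rewrite /= /from_subspace (conjugacy_funK hk)//; apply.
Qed.

Section LogGauge.
Variables (R : realType) (c K : R).
Hypotheses (c0 : 0 < c) (K2 : 2 <= K).

(** For [0 < r <= c / K ^ 2] this is [2 / n], where [n] is the real time in which a distance [r],
    multiplied by [K] at each step, reaches [c]. *)
Definition log_gauge (r : R) : R :=
  if r <= 0 then 0 else (Num.max 1 ((ln c - ln r) / (2 * ln K)))^-1.

Let lnK : 0 < ln K.
Proof. by apply: ln_gt0; move: K2; lra. Qed.

Lemma log_gauge_ge0 r : 0 <= log_gauge r.
Proof.
by rewrite /log_gauge; case: ifP => // _; rewrite invr_ge0 le_max ler01.
Qed.

Lemma log_gauge_le1 r : log_gauge r <= 1.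
Proof.
rewrite /log_gauge; case: ifP => // _.
by rewrite invf_le1 ?lt_max ?ltr01// le_max lexx.
Qed.

Lemma log_gauge_lt1 r : log_gauge r < 1 -> r < c.
Proof.
rewrite /log_gauge; case: ifPn => [r0 _|]; first exact: le_lt_trans r0 c0.
rewrite -ltNge => r0; rewrite invf_lt1 ?lt_max ?ltr01//= ltxx/=.
rewrite ltr_pdivlMr ?mulr_gt0// mul1r => h.
by rewrite -ltr_ln ?posrE// -subr_gt0 (lt_trans _ h)// mulr_gt0.
Qed.

Lemma log_gauge_ge r n : log_gauge r < 1 -> c <= K ^+ n * r ->
  2 <= n%:R * log_gauge r.
Proof.
move=> r1 cKr.
have K0 : 0 < K by move: K2; lra.
have r0 : 0 < r.
  have := lt_le_trans c0 cKr; by rewrite pmulr_rgt0// exprn_gt0.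
move: r1; rewrite /log_gauge leNgt r0/= => r1.
rewrite ler_pdivlMr ?lt_max ?ltr01//.
have : (ln c - ln r) <= n%:R * ln K.
  rewrite lerBlDr mulr_natl -lnXn// -lnM ?posrE ?exprn_gt0//.
  by rewrite ler_ln// ?posrE ?mulr_gt0 ?exprn_gt0.
move: r1; rewrite invf_lt1 ?lt_max ?ltr01//= ltxx/= => r1 h.
rewrite maxEle (ltW r1) mulrC -ler_pdivlMr// ler_pdivrMr ?mulr_gt0//.
by apply: le_trans h _; rewrite -[leRHS]/(_ * _); nra.
Qed.

Lemma continuous_log_gauge : continuous log_gauge.
Proof.
move=> r; rewrite /continuous_at; have [r0|r0|r0] := ltgtP r 0.
- apply: cvg_near_cst; near=> s; rewrite /log_gauge (ltW r0) ifT//.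
  apply: ltW; near: s.
  exact: lt_nbhsl.
- have -> : log_gauge r = (Num.max 1 ((ln c - ln r) / (2 * ln K)))^-1.
    by rewrite /log_gauge leNgt r0.
  apply: (@cvg_trans _ ((fun s => (Num.max 1 ((ln c - ln s) / (2 * ln K)))^-1)
     @ r)).
    apply: near_eq_cvg; near=> s; rewrite /log_gauge leNgt ifF//.
    by apply/negbTE/negPn; near: s; exact: lt_nbhsr.
  have lnr : (ln c - ln s) / (2 * ln K) @[s --> r] -->
      (ln c - ln r) / (2 * ln K).
    apply: cvgM; last exact: cvg_cst.
    apply: cvgB; first exact: cvg_cst.
    exact: continuous_ln.
  have maxr : Num.max 1 ((ln c - ln s) / (2 * ln K)) @[s --> r] -->
      Num.max 1 ((ln c - ln r) / (2 * ln K)).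
    pose f s : R^o := (ln c - ln s) / (2 * ln K).
    apply: (@continuous_max _ _ (cst 1) f r); last exact: lnr.
    exact: cst_continuous.
  by apply: (cvgV _ maxr); rewrite gt_eqF// lt_max ltr01.
- rewrite r0; apply/cvgrPdist_le => e e0.
  have -> : log_gauge 0 = 0 by rewrite /log_gauge lexx.
  (* Below [d] the quotient of logarithms exceeds [1 / e]. *)
  pose d := c * expR (- (2 * ln K / e)).
  have d0 : 0 < d by rewrite mulr_gt0 ?expR_gt0.
  near=> s; rewrite sub0r normrN ger0_norm ?log_gauge_ge0// /log_gauge.
  case: (leP s 0) => [_|s0]; first exact: ltW.
  have sd : s < d by near: s; exact: lt_nbhsl.
  rewrite invf_ple ?posrE ?lt_max ?ltr01// le_max; apply/orP; right.
  rewrite ler_pdivlMr ?mulr_gt0//.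
  have : ln s < ln d by rewrite ltr_ln ?posrE.
  rewrite lnM ?posrE ?expR_gt0// expRK mulrC; lra.
Unshelve. all: by end_near. Qed.

End LogGauge.

Section Gauge.
Variables (R : realType) (X : metricType R) (T Tinv : X -> X).
Hypotheses (TK : cancel T Tinv) (KT : cancel Tinv T).

Let ziterD := fun m n x => @ziterD X T Tinv m n x TK KT.

Lemma bilipschitz_ziter : bilipschitz T ->
  exists2 K : R, 2 <= K & forall j x y,
    mdist (ziter T Tinv j x) (ziter T Tinv j y) <= K ^+ `|j|%N * mdist x y.
Proof.
move=> [k k0 kT]; exists (Num.max 2 k); first by rewrite le_max lexx.
set K := Num.max 2 k.
have K0 : 0 <= K by rewrite le_max ler0n.
have kK : k <= K by rewrite le_max lexx orbT.
have TL x y : mdist (T x) (T y) <= K * mdist x y.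
  have /andP[_ h] := kT x y; apply: le_trans h _.
  by rewrite ler_wpM2r ?mdist_ge0.
have TiL x y : mdist (Tinv x) (Tinv y) <= K * mdist x y.
  have /andP[h _] := kT (Tinv x) (Tinv y).
  rewrite !KT ler_pdivrMl// in h; apply: le_trans h _.
  by rewrite ler_wpM2r ?mdist_ge0.
have itL (f : X -> X) n x y : (forall x y, mdist (f x) (f y) <= K * mdist x y) ->
    mdist (iter n f x) (iter n f y) <= K ^+ n * mdist x y.
  move=> fL; elim: n => [|n IH]; first by rewrite expr0 mul1r.
  by rewrite !iterS (le_trans (fL _ _))// exprS -mulrA ler_wpM2l.
by case=> n x y; exact: itL.
Qed.

Lemma continuous_mdist (y : X) : continuous (mdist y : X -> R).
Proof.
move=> z; apply/cvgrPdist_lt => e e0.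
apply/metricType_numDomainType.nbhs_mdistP; exists e => //= u zu.
have h1 := metric_triangle y z u; have h2 := metric_triangle y u z.
rewrite (metric_sym u z) in h2; move: zu h1 h2 => /=.
move: (mdist y z) (mdist y u) (mdist z u) => a b d; move: (e : R) => e1.
by rewrite ltr_norml => *; apply/andP; split; lra.
Qed.

(* A square root of the gauge [1 / log (1 / d(y, z))]: an orbit needs a time of
   order [1 / t z ^ 2] to come back near [y]. *)
Lemma exists_return_gauge (y : X) (c : R) : bilipschitz T -> 0 < c ->
  (forall j, j <> 0 -> c <= mdist y (ziter T Tinv j y)) ->
  exists t : X -> R, [/\ continuous t, t y = 0, forall z, 0 <= t z <= 1 &
    forall j z, j <> 0 -> t z < 1 -> t (ziter T Tinv j z) < 1 ->
      2 <= `|j|%N%:R * t z ^+ 2].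
Proof.
move=> /bilipschitz_ziter[K K2 TL] c0 yc.
(* If [T^j z] is within [c / 2] of [y] then, as [T^j y] is at least [c] away from [y], the distance
   between [y] and [z] has been stretched to at least [c / 2]. *)
pose g := log_gauge (c / 2) K.
have c20 : 0 < c / 2 by lra.
exists (fun z => Num.sqrt (g (mdist y z))); split.
- move=> z; apply: continuous_comp; last exact: sqrt_continuous.
  apply: continuous_comp; first exact: continuous_mdist.
  exact: continuous_log_gauge.
- by rewrite mdistxx /g /log_gauge lexx sqrtr0.
- move=> z; rewrite sqrtr_ge0/= -[leRHS]sqrtr1 ler_sqrt//.
  exact: log_gauge_le1.
- move=> j z j0.
  have sq1 r : (Num.sqrt (g r) < 1) = (g r < 1).
    by rewrite -[X in _ < X]sqrtr1 ltr_sqrt.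
  rewrite !sq1 sqr_sqrtr ?log_gauge_ge0// => gz gTz.
  apply: log_gauge_ge => //.
  have h1 := log_gauge_lt1 c20 K2 gTz.
  have h2 := metric_triangle y (ziter T Tinv j z) (ziter T Tinv j y).
  have := TL j z y; rewrite (metric_sym z y); have := yc _ j0.
  by move: h1 h2; set u := _ * mdist y z; lra.
Qed.

End Gauge.

(** * Two by two matrices *)

Section Matrices2.
Variable R : realType.
Implicit Types (M N : 'M[R]_2) (a b c d : R).

Lemma mx_norm_le m n (M : 'M[R]_(m, n)) a : 0 <= a ->
  (forall i j, `|M i j| <= a) -> `|M| <= a.
Proof.
move=> a0 Ma; rewrite [leLHS]/Num.Def.normr/= mx_normrE.
by apply: bigmax_le => // -[i j] _; exact: Ma.
Qed.

Lemma mx_norm_ge m n (M : 'M[R]_(m, n)) i j : `|M i j| <= `|M|.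
Proof.
rewrite [leRHS]/Num.Def.normr/= mx_normrE.
exact: (@le_bigmax _ _ _ _ (fun ij => `|M ij.1 ij.2|) (i, j)).
Qed.

Lemma mx_norm_mul M N : `|M *m N| <= 2 * `|M| * `|N|.
Proof.
apply: mx_norm_le => [|i j]; first by rewrite !mulr_ge0.
rewrite mxE (le_trans (ler_norm_sum _ _ _))//.
apply: (@le_trans _ _ (\sum_(k < 2) `|M| * `|N|)).
  by apply: ler_sum => k _; rewrite normrM ler_pM// mx_norm_ge.
by rewrite sumr_const card_ord -mulrA mulr_natl.
Qed.

Lemma opnorm_ub M v : enorm v = 1 -> enorm (M *m v) <= 2 * `|M|.
Proof.
have nM : 0 <= 2 * `|M| by rewrite mulr_ge0.
move=> v1; rewrite -(ger0_norm nM) -sqrtr_sqr /enorm ler_sqrt ?sqr_ge0//.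
have : (\sum_i v i 0 ^+ 2) = 1.
  rewrite -[LHS]sqr_sqrtr ?sumr_ge0// => [|i _]; last exact: sqr_ge0.
  by rewrite -/(enorm v) v1 expr1n.
rewrite !big_ord_recl !big_ord0 !mxE !big_ord_recl !big_ord0 !addr0.
have sq i j : M i j ^+ 2 <= `|M| ^+ 2.
  by rewrite -real_normK ?num_real// lerXn2r ?nnegrE// mx_norm_ge.
set o := lift ord0 ord0.
move: (sq ord0 ord0) (sq ord0 o) (sq o ord0) (sq o o).
move: (M ord0 ord0) (M ord0 o) (M o ord0) (M o o) `|M| (v ord0 0) (v o 0).
move=> m1 m2 m3 m4 K x y s1 s2 s3 s4 xy.
have cs a b : a ^+ 2 <= K ^+ 2 -> b ^+ 2 <= K ^+ 2 ->
    (a * x + b * y) ^+ 2 <= 2 * K ^+ 2.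
  move=> aK bK; apply: (@le_trans _ _ ((a ^+ 2 + b ^+ 2) * (x ^+ 2 + y ^+ 2))).
    by have := sqr_ge0 (a * y - b * x); lra.
  by rewrite xy mulr1; lra.
by have := cs m1 m2 s1 s2; have := cs m3 m4 s3 s4; lra.
Qed.

Lemma opnorm_le M : opnorm M <= 2 * `|M|.
Proof.
apply: ge_sup; last by move=> _ [v v1 <-]; exact: opnorm_ub.
exists (enorm (M *m delta_mx 0 0)), (delta_mx 0 0) => //=.
rewrite /enorm !big_ord_recl big_ord0 !mxE/= expr1n expr0n/= !addr0.
by rewrite sqrtr1.
Qed.

Lemma opnorm_ge M : `|M| <= opnorm M.
Proof.
have ub : has_ubound [set enorm (M *m v) | v in [set v | enorm v = 1]].
  by exists (2 * `|M|) => _ [v v1 <-]; exact: opnorm_ub.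
have e1 (j : 'I_2) : enorm (delta_mx j 0 : 'cV[R]_2) = 1.
  rewrite /enorm (bigD1 j)//= big1 => [|i ij].
    by rewrite mxE !eqxx expr1n addr0 sqrtr1.
  by rewrite mxE (negbTE ij) expr0n.
have le j : enorm (M *m delta_mx j 0) <= opnorm M.
  by apply: ub_le_sup => //; exists (delta_mx j 0) => //=; exact: e1.
have ent i j : `|M i j| <= opnorm M.
  apply: le_trans (le j); rewrite -sqrtr_sqr /enorm ler_sqrt; last first.
    by apply: sumr_ge0 => k _; exact: sqr_ge0.
  rewrite -colE (bigD1 i)//= mxE lerDl; apply: sumr_ge0 => k _; exact: sqr_ge0.
apply: mx_norm_le => //; exact: le_trans (normr_ge0 _) (ent 0 0).
Qed.

Definition mx22 a b c d : 'M[R]_2 :=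
  \matrix_(i, j) if i == 0 then (if j == 0 then a else b)
                 else (if j == 0 then c else d).

Lemma mx22_eq a b c d a' b' c' d' :
  a = a' -> b = b' -> c = c' -> d = d' -> mx22 a b c d = mx22 a' b' c' d'.
Proof. by move=> -> -> -> ->. Qed.

Lemma mul_mx22 a b c d a' b' c' d' :
  mx22 a b c d *m mx22 a' b' c' d' =
  mx22 (a * a' + b * c') (a * b' + b * d') (c * a' + d * c') (c * b' + d * d').
Proof.
apply/matrixP => i j; rewrite !mxE !big_ord_recl big_ord0 addr0 !mxE /=.
by case: ifP => _; case: ifP.
Qed.

Lemma mx22_1 : 1%:M = mx22 1 0 0 1.
Proof.
apply/matrixP => i j; rewrite !mxE.
by case: i => [[|[|//]] i2]; case: j => [[|[|//]] j2].
Qed.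

Lemma mx22_sub a b c d a' b' c' d' :
  mx22 a b c d - mx22 a' b' c' d' = mx22 (a - a') (b - b') (c - c') (d - d').
Proof.
by apply/matrixP => i j; rewrite !mxE; case: ifP => _; case: ifP.
Qed.

Lemma det_mx22 a b c d : \det (mx22 a b c d) = a * d - b * c.
Proof.
rewrite (expand_det_row _ 0) big_ord_recl big_ord1 /cofactor !det_mx11 !mxE/=.
by rewrite expr0 expr1; ring.
Qed.

Lemma mx22E M : M = mx22 (M 0 0) (M 0 1) (M 1 0) (M 1 1).
Proof.
apply/matrixP => i j; rewrite !mxE.
by case: i => [[|[|//]] i2]; case: j => [[|[|//]] j2];
  congr (M _ _); exact: val_inj.
Qed.

Lemma mx22_norm_le a b c d K : `|a| <= K -> `|b| <= K -> `|c| <= K ->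
  `|d| <= K -> `|mx22 a b c d| <= K.
Proof.
move=> aK bK cK dK; apply: mx_norm_le => [|i j]; first exact: le_trans aK.
by rewrite mxE; case: ifP => _; case: ifP.
Qed.

(** The inverse is the adjugate, whose entries are those of [M] up to order and sign. *)
Lemma det1_inverse M : \det M = 1 ->
  exists N, [/\ M *m N = 1%:M, N *m M = 1%:M & `|N| <= `|M|].
Proof.
rewrite (mx22E M); move: (mx_norm_ge M).
set a := M 0 0; set b := M 0 1; set c := M 1 0; set d := M 1 1 => Mle.
rewrite det_mx22 => dM; exists (mx22 d (- b) (- c) a); split.
- by rewrite mul_mx22 mx22_1; apply: mx22_eq; lra.
- by rewrite mul_mx22 mx22_1; apply: mx22_eq; lra.
- by rewrite -(mx22E M); apply: mx22_norm_le; rewrite ?normrN; exact: Mle.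
Qed.

Lemma cvg_mx22 (T : Type) (F : set_system T) {FF : Filter F}
    (a b c d : T -> R) a' b' c' d' :
  a x @[x --> F] --> a' -> b x @[x --> F] --> b' -> c x @[x --> F] --> c' ->
  d x @[x --> F] --> d' ->
  mx22 (a x) (b x) (c x) (d x) @[x --> F] --> mx22 a' b' c' d'.
Proof.
move=> /cvgrPdist_le ha /cvgrPdist_le hb /cvgrPdist_le hc /cvgrPdist_le hd.
apply/cvgrPdist_le => e e0.
near=> x; rewrite mx22_sub; apply: mx22_norm_le; near: x.
- exact: ha.
- exact: hb.
- exact: hc.
- exact: hd.
Unshelve. all: by end_near. Qed.

End Matrices2.

(** * The model of a passage near the orbit *)

Section ModelPassage.
Variables (R : realType) (e : R).
Implicit Types (s : R) (n : nat) (m : int).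

Let q := e^-1.

Definition saddle : 'M[R]_2 := mx22 e 0 0 q.

(** The weight climbs linearly from [s] to 1 in a time of order [1 / s]. Linear growth makes the
    ratios of consecutive weights tend to 1 uniformly in [s]. *)
Definition wt n s : R := Num.min 1 (s * n.+1%:R).

(* [wt n.-1 s / wt n s], extended to [s = 0] by its limit (see [wtS]). *)
Definition wt_ratio n s : R := Num.max (Num.min 1 (s * n%:R)) (n%:R / n.+1%:R).

(* [frame m s] is the matrix [B] at time [m] of a passage with [t = s]: its
   columns are the expanding and the contracting vector.  The times [- n] and
   [n + 1] are exchanged by time reversal, that is by conjugation with the swap
   of the two coordinates.  [step m s] is [frame (m + 1) s * D / frame m s],
   simplified so that it makes sense at [s = 0]. *)
Definition frame_past n s :=
  mx22 (wt n s)^-1 (q ^+ (2 * n).+1 * ((wt n s)^-1 - wt n s)) 0 (wt n s).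
Definition frame_future n s :=
  mx22 (wt n s) 0 (q ^+ (2 * n).+1 * ((wt n s)^-1 - wt n s)) (wt n s)^-1.

Definition step_past n s (r := wt_ratio n s) :=
  mx22 (e / r) (q ^+ (2 * n) * (r^-1 - r)) 0 (q * r).
Definition step_now s :=
  mx22 (e * s ^+ 2) (s ^+ 2 - 1) (1 - s ^+ 2) (q * (2 - s ^+ 2)).
Definition step_future n s (r := wt_ratio n s) :=
  mx22 (e / r) 0 (- (q ^+ (2 * n) * (r^-1 - r))) (q * r).

Definition frame m s :=
  match m with
  | Posz 0 => frame_past 0 s
  | Posz n.+1 => frame_future n s
  | Negz n => frame_past n.+1 s
  end.

Definition step m s :=
  match m with
  | Posz 0 => step_now s
  | Posz n.+1 => step_future n.+1 s
  | Negz n => step_past n.+1 s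
  end.

Hypothesis e1 : 1 <= e.

Let e0 : 0 < e. Proof. exact: lt_le_trans e1. Qed.
Let en0 : e != 0. Proof. by rewrite gt_eqF. Qed.
Let q0 : 0 < q. Proof. by rewrite invr_gt0. Qed.
Let q1 : q <= 1. Proof. by rewrite invf_le1. Qed.

Lemma wt_gt0 n s : 0 < s -> 0 < wt n s.
Proof. by move=> s0; rewrite lt_min ltr01 mulr_gt0. Qed.

Lemma wt_le1 n s : wt n s <= 1.
Proof. by rewrite ge_min lexx. Qed.

Lemma wt_eq1 n s : 1 <= s * n.+1%:R -> wt n s = 1.
Proof. by move=> h; apply/min_idPl. Qed.

Lemma wt_ratio_ge n s : n%:R / n.+1%:R <= wt_ratio n s.
Proof. by rewrite le_max lexx orbT. Qed.

Lemma wt_ratio_gt0 n s : 0 < wt_ratio n.+1 s.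
Proof. by apply: lt_le_trans (wt_ratio_ge _ _); rewrite divr_gt0. Qed.

Lemma wt_ratio_le1 n s : wt_ratio n s <= 1.
Proof.
by rewrite ge_max ge_min lexx/= ler_pdivrMr// mul1r ler_nat leqnSn.
Qed.

Lemma wt_ratio_eq1 n s : 1 <= s * n%:R -> wt_ratio n s = 1.
Proof.
move=> h; apply/eqP; rewrite eq_le wt_ratio_le1 /wt_ratio.
by rewrite (min_idPl h) le_max lexx.
Qed.

Lemma wtS n s : 0 < s -> wt n s = wt_ratio n.+1 s * wt n.+1 s.
Proof.
move=> s0; rewrite /wt /wt_ratio.
have n2 : 0 < n.+2%:R :> R by [].
have [h1|h1] := leP 1 (s * n.+1%:R).
  have h2 : 1 <= s * n.+2%:R by rewrite (le_trans h1)// ler_pM2l// ler_nat.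
  rewrite (min_idPl h2) mulr1; apply/esym/max_idPl.
  by rewrite ler_pdivrMr// mul1r ler_nat.
have [h2|h2] := leP 1 (s * n.+2%:R).
  rewrite mulr1; apply/esym/max_idPl.
  by rewrite ler_pdivrMr// mulrAC ler_peMl.
rewrite (_ : Num.max _ _ = n.+1%:R / n.+2%:R).
  by rewrite mulrCA divfK// pnatr_eq0.
by apply/max_idPr; rewrite ler_pdivlMr// mulrAC ler_piMl// ltW.
Qed.

Lemma step_frame m s : 0 < s -> s <= 1 ->
  step m s *m frame m s = frame (m + 1) s *m saddle.
Proof.
move=> s0 s1.
have sn0 : s != 0 by rewrite gt_eqF.
have qe : q * e = 1 by rewrite mulVf.
have past n : step_past n.+1 s *m frame_past n.+1 s = frame_past n s *m saddle.
  rewrite /frame_past /step_past /saddle !mul_mx22 (wtS n s0).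
  have vn0 : wt n.+1 s != 0 by rewrite gt_eqF// wt_gt0.
  have rn0 : wt_ratio n.+1 s != 0 by rewrite gt_eqF// wt_ratio_gt0.
  rewrite (_ : (2 * n.+1).+1 = ((2 * n).+1).+2)%N; last by rewrite mulnS.
  rewrite (_ : (2 * n.+1) = ((2 * n).+1).+1)%N; last by rewrite mulnS.
  rewrite !exprS; move: (q ^+ (2 * n)) => Q.
  apply: mx22_eq; rewrite /q; field; rewrite ?en0 ?vn0 ?rn0//.
case: m => [[|n]|[|n]].
- rewrite /= /frame_past /step_now /frame_future /saddle !mul_mx22.
  rewrite (_ : wt 0 s = s); last by rewrite /wt mulr1; apply/min_idPr.
  by apply: mx22_eq; rewrite /q; field; rewrite ?en0 ?sn0.
- rewrite -PoszD addn1 /= /frame_future /step_future /saddle !mul_mx22 (wtS n s0).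
  have vn0 : wt n.+1 s != 0 by rewrite gt_eqF// wt_gt0.
  have rn0 : wt_ratio n.+1 s != 0 by rewrite gt_eqF// wt_ratio_gt0.
  rewrite (_ : (2 * n.+1).+1 = ((2 * n).+1).+2)%N; last by rewrite mulnS.
  rewrite (_ : (2 * n.+1) = ((2 * n).+1).+1)%N; last by rewrite mulnS.
  rewrite !exprS; move: (q ^+ (2 * n)) => Q.
  by apply: mx22_eq; rewrite /q; field; rewrite ?en0 ?vn0 ?rn0.
- exact: past.
- rewrite (_ : Negz n.+1 + 1 = Negz n); last by lia.
  exact: past.
Qed.

Lemma det_step m s : \det (step m s) = 1.
Proof.
have rn0 n : wt_ratio n.+1 s != 0 by rewrite gt_eqF// wt_ratio_gt0.
by case: m => [[|n]|n]; rewrite /= det_mx22 /q; field; rewrite ?en0 ?rn0.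
Qed.

Lemma det_frame m s : 0 < s -> \det (frame m s) = 1.
Proof.
move=> s0; have vn0 n : wt n s != 0 by rewrite gt_eqF// wt_gt0.
by case: m => [[|n]|n]; rewrite /= det_mx22 /q; field; rewrite ?en0 ?vn0.
Qed.

(** Time [m] of a passage with [t = s] is active while [s * width m < 1]; otherwise [step] and
    [frame] are trivial. *)
Definition width m : R := (maxn 1 `|m|)%:R.

Let max1S n : maxn 1 n.+1 = n.+1. Proof. exact/maxn_idPr. Qed.

Lemma step_trivial m s : s <= 1 -> 1 <= s * width m -> step m s = saddle.
Proof.
move=> s1; rewrite /width; case: m => [[|n]|n] /=; rewrite ?max1S.
- rewrite mulr1 => s1'; have -> : s = 1 by apply/eqP; rewrite eq_le s1.
  by apply: mx22_eq; rewrite expr1n; ring.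
- move=> /wt_ratio_eq1 h; rewrite /step_future h invr1 subrr !mulr0 oppr0.
  by rewrite !mulr1.
- move=> /wt_ratio_eq1 h; rewrite /step_past h invr1 subrr !mulr0.
  by rewrite !mulr1.
Qed.

Lemma frame_past_eq1 n s : 1 <= s * n.+1%:R -> frame_past n s = 1%:M.
Proof.
by move=> /wt_eq1 h; rewrite /frame_past h invr1 subrr mulr0 mx22_1.
Qed.

Lemma frame_future_eq1 n s : 1 <= s * n.+1%:R -> frame_future n s = 1%:M.
Proof.
by move=> /wt_eq1 h; rewrite /frame_future h invr1 subrr mulr0 mx22_1.
Qed.

Lemma frame_trivial m s : 0 <= s -> 1 <= s * width m -> frame m s = 1%:M.
Proof.
move=> s0; rewrite /width; case: m => [[|n]|n] /=; rewrite ?max1S => h.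
- exact: frame_past_eq1.
- by apply: frame_future_eq1; apply: le_trans h _.
- apply: frame_past_eq1; apply: le_trans h _.
  by rewrite ler_wpM2l// ler_nat.
Qed.

(** [frame m] sits between [step (m - 1)] and [step m]. Together with [frame_trivial], this makes it
    the identity as soon as either of the two times is inactive. *)
Lemma frame_next_trivial m s : 0 <= s -> 1 <= s * width (m - 1) ->
  frame m s = 1%:M.
Proof.
move=> s0; rewrite /width; case: m => [[|n]|n] h.
- exact: frame_past_eq1.
- apply: frame_future_eq1; apply: le_trans h _; rewrite ler_wpM2l// ler_nat.
  by lia.
- apply: frame_past_eq1; apply: le_trans h _; rewrite ler_wpM2l// ler_nat.
  by lia.
Qed.

Lemma frame_norm m s w : 0 < w -> w <= 1 -> w <= s * width m ->
  `|frame m s| <= w^-1.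
Proof.
move=> w0 w1 ws.
have s0 : 0 < s by have := lt_le_trans w0 ws; rewrite pmulr_lgt0// ltr0n; lia.
have ent n : w <= s * n.+1%:R ->
   [/\ `|wt n s| <= w^-1, `|(wt n s)^-1| <= w^-1 &
    `|q ^+ (2 * n).+1 * ((wt n s)^-1 - wt n s)| <= w^-1].
  move=> wn; have v0 := wt_gt0 n s0; have v1 := wt_le1 n s.
  have vi : (wt n s)^-1 <= w^-1 by rewrite lef_pV2// le_min w1.
  have v1i : 1 <= (wt n s)^-1 by rewrite invf_ge1.
  have vd : 0 <= (wt n s)^-1 - wt n s by lra.
  split; [by rewrite ger0_norm; lra|by rewrite ger0_norm; lra|].
  rewrite ger0_norm ?mulr_ge0 ?exprn_ge0 ?(ltW q0)//.
  apply: le_trans (_ : (wt n s)^-1 - wt n s <= _); last by lra.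
  by apply: ler_piMl => //; apply: exprn_ile1 => //; exact: ltW.
have z0 : `|0 : R| <= w^-1 by rewrite normr0 invr_ge0 ltW.
move: ws; rewrite /width; case: m => [[|n]|n] /=; rewrite ?max1S => ws.
- by have [//|h1 h2 h3] := ent 0%N; apply: mx22_norm_le.
- by have [|h1 h2 h3] := ent n; [exact: le_trans ws _|apply: mx22_norm_le].
- have [|h1 h2 h3] := ent n.+1; last exact: mx22_norm_le.
  by apply: le_trans ws _; rewrite ler_pM2l// ler_nat.
Qed.

(** With [n = |m|], the ratio [r] is at least [n / (n + 1)], so [r] and its inverse are within
    [1 / n] of 1. The bound is uniform in [s], including [s = 0]; continuity of the cocycle rests on
    this. *)
Lemma step_dist m s : m != 0 -> `|step m s - saddle| <= 2 * e / `|m|%N%:R.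
Proof.
have key (r ri x : R) k : 0 <= x -> 0 < r -> r <= 1 -> 1 <= ri ->
    ri <= 1 + x -> 1 - r <= x ->
    [/\ `|e * ri - e| <= 2 * (e * x), `|q ^+ k * (ri - r)| <= 2 * (e * x) &
       `|q * r - q| <= 2 * (e * x)].
  move=> x0 r0 r1 ri1 rix rx.
  have ex : x <= e * x by rewrite ler_peMl.
  have ex0 : 0 <= e * x by lra.
  split.
  - have -> : e * ri - e = e * (ri - 1) by ring.
    rewrite ger0_norm ?mulr_ge0 ?(ltW e0)//; last by lra.
    have : e * (ri - 1) <= e * x by rewrite ler_pM2l//; lra.
    by lra.
  - rewrite ger0_norm ?mulr_ge0 ?exprn_ge0 ?(ltW q0)//; last by lra.
    apply: le_trans (_ : ri - r <= _); last by lra.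
    by apply: ler_piMl; [lra|apply: exprn_ile1 => //; exact: ltW].
  - have -> : q * r - q = - (q * (1 - r)) by ring.
    rewrite normrN ger0_norm ?mulr_ge0 ?(ltW q0)//; last by lra.
    have : q * (1 - r) <= 1 - r by apply: ler_piMl; [lra|exact: q1].
    by lra.
have rt n : let r := wt_ratio n.+1 s in let K := 2 * e / n.+1%:R in
   [/\ `|e / r - e| <= K, `|q ^+ (2 * n.+1) * (r^-1 - r)| <= K &
       `|q * r - q| <= K].
  move=> r K; have r0 : 0 < r := wt_ratio_gt0 n s.
  have r1 : r <= 1 := wt_ratio_le1 n.+1 s.
  have n0 : 0 < n.+1%:R :> R by [].
  have ni0 : 0 <= n.+1%:R^-1 :> R by rewrite invr_ge0 ltW.
  have ri : 1 <= r^-1 by rewrite invf_ge1.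
  have rb : r^-1 <= 1 + n.+1%:R^-1.
    have h : n.+1%:R / n.+2%:R <= r := wt_ratio_ge n.+1 s.
    rewrite -[leRHS]invrK lef_pV2 ?posrE ?invr_gt0; last 2 first.
    - exact: r0.
    - by rewrite ltr_pwDl.
    apply: le_trans h; rewrite le_eqVlt; apply/orP; left; apply/eqP.
    have -> : n.+2%:R = n.+1%:R + 1 :> R by rewrite natr1.
    move: (n.+1%:R : R) n0 => a a0.
    by field; rewrite !gt_eqF ?addr_gt0.
  have r2 : 1 - r <= n.+1%:R^-1.
    have h : r * r^-1 = 1 by rewrite divff// gt_eqF.
    have : r * r^-1 <= r * (1 + n.+1%:R^-1) by rewrite ler_pM2l.
    have : r * n.+1%:R^-1 <= n.+1%:R^-1 by apply: ler_piMl.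
    by rewrite h; move: n.+1%:R^-1 (r : R) => x y; lra.
  rewrite /K -mulrA; exact: key.
have K0 n : `|0 - 0 : R| <= 2 * e / n.+1%:R.
  by rewrite subrr normr0 divr_ge0// mulr_ge0// ltW.
case: m => [[//|n]|n] _ /=; have [h1 h2 h3] := rt n;
  rewrite /saddle mx22_sub; apply: mx22_norm_le => //; rewrite subr0//.
by rewrite normrN.
Qed.

Lemma continuous_step m : continuous (step m).
Proof.
have crt n : continuous (wt_ratio n).
  have cmul : continuous (fun s : R => s * n%:R : R^o).
    by move=> s; apply: cvgM; [exact: cvg_id|exact: cvg_cst].
  have cmin : continuous (fun s => Num.min 1 (s * n%:R) : R^o).
    move=> s; apply: (@continuous_min R R (cst 1) (fun s => s * n%:R) s).
      exact: cst_continuous.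
    exact: cmul.
  move=> s; apply: (@continuous_max R R (fun s => Num.min 1 (s * n%:R))
    (cst (n%:R / n.+1%:R)) s).
    exact: cmin.
  exact: cst_continuous.
have cinv n : continuous (fun s => (wt_ratio n.+1 s)^-1).
  by move=> s; apply: cvgV; [rewrite gt_eqF// wt_ratio_gt0|exact: crt].
have off n (s : R) : q ^+ (2 * n.+1) * ((wt_ratio n.+1 u)^-1 - wt_ratio n.+1 u)
    @[u --> s] --> q ^+ (2 * n.+1) * ((wt_ratio n.+1 s)^-1 - wt_ratio n.+1 s).
  by apply: cvgM; [exact: cvg_cst|apply: cvgB; [exact: cinv|exact: crt]].
have big n (s : R) : e / wt_ratio n.+1 u @[u --> s] --> e / wt_ratio n.+1 s.
  by apply: cvgM; [exact: cvg_cst|exact: cinv].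
have small n (s : R) : q * wt_ratio n.+1 u @[u --> s] --> q * wt_ratio n.+1 s.
  by apply: cvgM; [exact: cvg_cst|exact: crt].
have sq (s : R) : u ^+ 2 @[u --> s] --> s ^+ 2 by exact: exprn_continuous.
case: m => [[|n]|n] s; rewrite /continuous_at /=.
- apply: cvg_mx22.
  + by apply: cvgM; [exact: cvg_cst|exact: sq].
  + by apply: cvgB; [exact: sq|exact: cvg_cst].
  + by apply: cvgB; [exact: cvg_cst|exact: sq].
  + apply: cvgM; first exact: cvg_cst.
    by apply: cvgB; [exact: cvg_cst|exact: sq].
- by apply: cvg_mx22; [exact: big|exact: cvg_cst|apply: cvgN; exact: off|
    exact: small].
- by apply: cvg_mx22; [exact: big|exact: off|exact: cvg_cst|exact: small].
Qed.

(** The product of the steps with [s = 0] over the times [- n] to [n]. It maps the first axis,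
    expanded at negative times, onto the second, contracted at positive times, and the two effects
    cancel. *)
Definition swap n : 'M[R]_2 := mx22 0 (-1) 1 (2 * q ^+ (2 * n).+1).

Lemma swap0 : step 0 0 = swap 0.
Proof. by apply: mx22_eq; rewrite ?expr0n ?expr1/=; ring. Qed.

Lemma swapS n s :
  step n.+1%:Z s *m swap n *m step (- n.+1%:Z) s = swap n.+1.
Proof.
have rn0 : wt_ratio n.+1 s != 0 by rewrite gt_eqF// wt_ratio_gt0.
rewrite -NegzE /= /swap !mul_mx22.
rewrite (_ : (2 * n.+1).+1 = ((2 * n).+1).+2)%N; last by rewrite mulnS.
rewrite (_ : (2 * n.+1) = ((2 * n).+1).+1)%N; last by rewrite mulnS.
rewrite !exprS; move: (q ^+ (2 * n)) => Q.
by apply: mx22_eq; rewrite /q; field; rewrite ?en0 ?rn0.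
Qed.

Lemma swap_norm n : `|swap n| <= 2.
Proof.
apply: mx22_norm_le; rewrite ?normr0 ?normrN ?normr1 ?ler1n//.
rewrite ger0_norm ?mulr_ge0 ?exprn_ge0 ?(ltW q0)//.
by rewrite ler_piMr//; apply: exprn_ile1 => //; exact: ltW.
Qed.

End ModelPassage.

(** * Visits near the orbit are rare *)

Section Returns.
Variables (R : realType) (X : pmetricType R) (T Tinv : X -> X).
Variables (t : X -> R) (mu : probability (borel X) R).
Hypotheses (TK : cancel T Tinv) (KT : cancel Tinv T).
Hypotheses (Tc : continuous T) (Tic : continuous Tinv) (tc : continuous t).
Hypothesis t01 : forall z, 0 <= t z <= 1.
Hypothesis t_sep : forall j z, j <> 0 -> t z < 1 -> t (ziter T Tinv j z) < 1 ->
  2 <= `|j|%N%:R * t z ^+ 2.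
Hypothesis muT : invariant_measure T mu.

Lemma continuous_ziter j : continuous (ziter T Tinv j).
Proof.
have citer (f : X -> X) n : continuous f -> continuous (iter n f).
  move=> fc; elim: n => [|n IH] x; first exact: cvg_id.
  by apply: continuous_comp; [exact: IH|exact: fc].
by case: j => n; exact: citer.
Qed.

Lemma open_preimage_ziter j (U : set X) :
  open U -> open (ziter T Tinv j @^-1` U).
Proof. by move=> oU; apply: open_comp => // x _; exact: continuous_ziter. Qed.

Lemma measurable_open_borel (U : set X) :
  open U -> measurable (U : set (borel X)).
Proof. by move=> oU; exact: sub_sigma_algebra. Qed.

Lemma measure_preimage_ziter j (U : set X) : open U ->
  mu (ziter T Tinv j @^-1` U) = mu U.
Proof.
have fwd (V : set X) : open V -> mu (T @^-1` V) = mu V.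
  by move=> oV; apply: muT; exact: measurable_open_borel.
have bwd (V : set X) : open V -> mu (Tinv @^-1` V) = mu V.
  move=> oV; rewrite -fwd; last by apply: open_comp => // x _; exact: Tic.
  by congr (mu _); apply/funext => x; rewrite /preimage/= TK.
have it (f : X -> X) n (V : set X) : continuous f ->
    (forall W : set X, open W -> mu (f @^-1` W) = mu W) -> open V ->
    mu (iter n f @^-1` V) = mu V.
  move=> fc fmu; elim: n V => [//|n IH] V oV.
  rewrite -(fmu V)// -(IH (f @^-1` V))//.
  by apply: open_comp => // x _; exact: fc.
by case: j => n oU; exact: it.
Qed.

Let near_set (n : nat) : set X := [set z | t z < n.+1%:R^-1].

Let open_near n : open (near_set n).
Proof.
rewrite (_ : near_set n = t @^-1` [set r | r < n.+1%:R^-1])//.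
by apply: open_comp; [move=> x _; exact: tc|exact: open_lt].
Qed.

(* The first [(n + 1) ^ 2] preimages of the set are pairwise disjoint. *)
Lemma measure_near n : (mu (near_set n) <= ((n.+1%:R ^+ 2)^-1)%:E)%E.
Proof.
pose N := (n.+1 ^ 2)%N.
pose G (i : 'I_N) : set (borel X) := ziter T Tinv i%:Z @^-1` near_set n.
have mG i : measurable (G i).
  by apply: measurable_open_borel; exact: open_preimage_ziter.
have tG : trivIset setT G.
  apply/trivIsetP => i i' _ _; wlog ii' : i i' / (i < i')%N.
    move=> wl ii; have [h|h|/val_inj h] := ltngtP i i'; first exact: wl.
      by rewrite setIC; apply: wl => //; rewrite eq_sym.
    by rewrite h eqxx in ii.
  move=> _; rewrite -subset0 => x [xi xi'].
  pose z := ziter T Tinv i%:Z x; have tz : t z < n.+1%:R^-1 := xi.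
  have tz' : t (ziter T Tinv (i'%:Z - i%:Z) z) < n.+1%:R^-1.
    by rewrite /z -ziterD// subrK.
  have n1 : n.+1%:R^-1 <= 1 :> R by rewrite invf_le1// ler1n.
  have j0 : i'%:Z - i%:Z <> 0 by lia.
  (* Two visits less than [(n + 1) ^ 2] apart would give [2 <= 1]. *)
  have := t_sep j0 (lt_le_trans tz n1) (lt_le_trans tz' n1).
  have -> : `|(i'%:Z - i%:Z)%R|%N = (i' - i)%N by lia.
  have /andP[t0 _] := t01 z.
  have tz2 : t z ^+ 2 <= (n.+1%:R^-1) ^+ 2.
    by rewrite lerXn2r ?nnegrE ?invr_ge0// ltW.
  have : (i' - i)%N%:R * t z ^+ 2 <= N%:R * (n.+1%:R^-1) ^+ 2.
    apply: ler_pM => //; first exact: sqr_ge0.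
    by rewrite ler_nat; have := ltn_ord i'; lia.
  rewrite /N natrX -exprMn divff ?pnatr_eq0// expr1n; lra.
have := @measure_bigsetU_ord _ _ _ mu N xpredT G mG tG.
rewrite (eq_bigr (fun=> mu (near_set n))); last first.
  by move=> i _; exact: (measure_preimage_ziter i%:Z (open_near n)).
have mU : measurable (near_set n : set (borel X)).
  by apply: measurable_open_borel; exact: open_near.
have finU : mu (near_set n) \is a fin_num by exact: fin_num_measure.
have : (mu (\big[setU/set0]_(i < N) G i) <= 1)%E.
  by apply: probability_le1; apply: bigsetU_measurable => i _; exact: mG.
move=> /[swap] ->; rewrite -(fineK finU) sumEFin !lee_fin sumr_const card_ord.
by rewrite -[_ *+ N]mulr_natl -ler_pdivlMl ?ltr0n// mulr1 /N natrX.
Qed.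

(** Borel-Cantelli: by invariance the [n]-th exceptional set has the measure of [near_set n], at
    most [1 / (n + 1) ^ 2], whatever the times [j n]. *)
Lemma ae_eventually_far (j : nat -> int) :
  \forall x \ae mu, exists N, forall n, (N <= n)%N ->
    n.+1%:R^-1 <= t (ziter T Tinv (j n) x).
Proof.
pose E n : set (borel X) := ziter T Tinv (j n) @^-1` near_set n.
have mE n : measurable (E n).
  by apply: measurable_open_borel; exact: open_preimage_ziter.
have sE : (\sum_(n <oo) mu (E n) < +oo)%E.
  apply: le_lt_trans (_ : 2%:E < +oo)%E; last exact: ltry.
  apply: lime_le; first exact: is_cvg_nneseries.
  apply: nearW => n.
  (* The induction on partial sums needs a bound stronger than 2. *)
  apply: (@le_trans _ _ (2 - 2 / n.+1%:R)%:E); last first.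
    by rewrite lee_fin lerBlDr lerDl divr_ge0.
  elim: n => [|n IH]; first by rewrite big_geq// lee_fin; lra.
  rewrite big_nat_recr//=.
  apply: le_trans (leeD IH (_ : _ <= ((n.+1%:R ^+ 2)^-1)%:E)%E) _.
    rewrite (_ : mu (E n) = mu (near_set n)); first exact: measure_near.
    exact: (measure_preimage_ziter (j n) (open_near n)).
  rewrite -EFinD lee_fin.
  have -> : n.+2%:R = n.+1%:R + 1 :> R by rewrite natr1.
  have : 1 <= n.+1%:R :> R by rewrite ler1n.
  move: (n.+1%:R : R) => a a1.
  move=> {IH}; have h : 2 - 2 / (a + 1) - (2 - 2 / a + a ^- 2) =
      (a - 1) / (a ^+ 2 * (a + 1)) by field; apply/andP; split; lra.
  rewrite -[_ <= _]subr_ge0 h divr_ge0 ?mulr_ge0 ?sqr_ge0//; lra.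
have := lim_sup_set_cvg0 mE sE.
move=> h; exists (lim_sup_set E); split.
- apply: bigcapT_measurable => k; apply: bigcup_measurable => i _; exact: mE.
- exact: h.
move=> x /= xN n _; apply: contrapT => xE; apply: xN; exists n => k nk.
rewrite leNgt; apply/negP => kE; apply: xE; exists k => //.
Qed.

(* Applied to a constant sequence, the previous lemma says that the orbit of
   almost every point avoids the zeros of [t]. *)
Lemma ae_slow_approach :
  \forall x \ae mu, exists2 c : R, 0 < c <= 1 &
    forall j : int, c <= t (ziter T Tinv j x) * (`|j|%N.+1)%:R.
Proof.
have aeF : Filter (almost_everywhere mu) := ae_filter_ringOfSetsType mu.
have pos j : \forall x \ae mu, 0 < t (ziter T Tinv j x).
  apply: filterS (ae_eventually_far (fun=> j)) => x [N /(_ N (leqnn N))].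
  by apply: lt_le_trans; rewrite invr_gt0.
have fwd := ae_eventually_far (fun n => n%:Z).
have bwd := ae_eventually_far (fun n => - n%:Z).
have pf := ae_foralln (fun n => pos n%:Z).
have pb := ae_foralln (fun n => pos (- n%:Z)).
have side (u : nat -> R) : (forall n, 0 < u n) ->
    (exists N, forall n, (N <= n)%N -> n.+1%:R^-1 <= u n) ->
    exists2 c : R, 0 < c <= 1 & forall n, c <= u n * n.+1%:R.
  move=> u0 [N uN].
  (* Before [N] there are finitely many values, all positive; from [N] on, [u n * (n + 1)] is at
     least 1. *)
  pose c := \big[Num.min/1]_(k < N) u k.
  exists c.
    rewrite bigmin_le_id andbT lt_bigmin//; exact: ltr01.
  move=> n; have [nN|Nn] := ltnP n N.
    apply: (@le_trans _ _ (u n)); first exact: (bigmin_le _ (Ordinal nN) (fun k : 'I_N => u k)).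
    by rewrite ler_peMr ?ler1n ?ltW.
  apply: (@le_trans _ _ 1); first exact: bigmin_le_id.
  by rewrite -ler_pdivrMr// div1r uN.
apply: filterS2 (filterI fwd bwd) (filterI pf pb) => x [f b] [f0 b0].
have [c1 /andP[c10 c11] h1] := side _ f0 f.
have [c2 /andP[c20 c21] h2] := side _ b0 b.
exists (Num.min c1 c2); first by rewrite lt_min c10 c20 ge_min c11.
case=> n; first by rewrite ge_min h1.
have := h2 n.+1; rewrite -NegzE => h; by rewrite ge_min h orbT.
Qed.

End Returns.

(** * The cocycle *)

Lemma width_ge1 (R : realType) m : 1 <= width R m.
Proof. by rewrite /width ler1n leq_maxl. Qed.

Section Cocycle.
Variables (R : realType) (X : pmetricType R) (T Tinv : X -> X).
Variables (t : X -> R) (e : R).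
Hypotheses (TK : cancel T Tinv) (KT : cancel Tinv T).
Hypotheses (Tc : continuous T) (Tic : continuous Tinv) (tc : continuous t).
Hypothesis t01 : forall z, 0 <= t z <= 1.
Hypothesis t_sep : forall j z, j <> 0 -> t z < 1 -> t (ziter T Tinv j z) < 1 ->
  2 <= `|j|%N%:R * t z ^+ 2.
Hypothesis e1 : 1 <= e.

Let t_ge0 z : 0 <= t z. Proof. by have /andP[] := t01 z. Qed.
Let t_le1 z : t z <= 1. Proof. by have /andP[] := t01 z. Qed.

(** If [x] is at time [m] of a passage, time 0 of that passage is at [T^(-m) x], and [tz m x] is its
    parameter [s]. *)
Let tz (m : int) x := t (ziter T Tinv (- m) x).
Let passes (m : int) x := tz m x * width R m < 1.

(** Let [|m| <= |k|], [w = width k] and [s = tz k x]. Two passages would be centred at most [2 * w]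
    apart in time, so [t_sep] gives [2 <= 2 * w * s ^ 2], against [s * w < 1] and [s < 1]. *)
Lemma passes_uniq m k x : passes m x -> passes k x -> m = k.
Proof.
wlog mk : m k / (`|m| <= `|k|)%N.
  move=> wl pm pk; have [mk|/ltnW km] := leqP `|m| `|k|; first exact: wl.
  by apply/esym; exact: wl.
move=> pm pk; apply: contrapT => nmk.
have lt1 l : passes l x -> tz l x < 1.
  by apply: le_lt_trans; rewrite ler_peMr ?t_ge0// width_ge1.
have jE : ziter T Tinv (k - m) (ziter T Tinv (- k) x) = ziter T Tinv (- m) x.
  by rewrite -ziterD//; congr (ziter _ _ _ _); lia.
have j0 : k - m <> 0 by lia.
have := @t_sep (k - m) (ziter T Tinv (- k) x) j0 (lt1 _ pk).
rewrite jE => /(_ (lt1 _ pm)); rewrite -/(tz k x).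
have := pk; rewrite /passes; have := lt1 _ pk; have : 0 <= tz k x by exact: t_ge0.
have : `|(k - m)%R|%N%:R <= 2 * width R k.
  by rewrite /width -natrM ler_nat; lia.
have := width_ge1 R k.
move: (tz k x) (width R k) (`|_|%N%:R) => s w a w1 aw s0 s1 sw.
have : a * s ^+ 2 <= 2 * w * s ^+ 2 by rewrite ler_wpM2r ?sqr_ge0.
have : s * (s * w) <= s * 1 by rewrite ler_wpM2l// ltW.
by lra.
Qed.

Let kappa x : int := xget 0 [set m | passes m x].

Lemma passes_kappa m x : passes m x -> kappa x = m.
Proof.
move=> pm; apply: (passes_uniq _ pm).
exact: (xgetI 0 (pm : [set k | passes k x] m)).
Qed.

(* When no [m] passes, [kappa x] is the default [0], for which [step] and
   [frame] are trivial as well. *)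
Definition generator x := step e (kappa x) (tz (kappa x) x).
Definition conjugator x := frame e (kappa x) (tz (kappa x) x).

Let model m x := step e m (tz m x).

Lemma model_eq_saddle m x : m <> kappa x -> model m x = saddle e.
Proof.
move=> mk; apply: step_trivial; first exact: t_le1.
by rewrite leNgt; apply/negP => /passes_kappa km; exact: mk.
Qed.

Lemma generator_passes m x : passes m x -> generator x = model m x.
Proof. by rewrite /generator => /passes_kappa ->. Qed.

(** At each point at most one of the models differs from the saddle. Hence two differences of models
    with a common index suffice, and continuity reduces to equicontinuity of the family of
    models. *)
Lemma generatorB x y :
  generator x - generator y =
    (model (kappa x) x - model (kappa x) y) +
    (if kappa x == kappa y then 0
     else model (kappa y) x - model (kappa y) y).
Proof.
rewrite /generator; case: eqP => [->|xy]; first by rewrite addr0.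
rewrite (@model_eq_saddle (kappa x) y)// (@model_eq_saddle (kappa y) x).
  by rewrite subrKA.
by move=> yx; apply: xy.
Qed.

Lemma model_equicontinuous x (d : R) : 0 < d ->
  \forall y \near x, forall m, `|model m x - model m y| <= d.
Proof.
move=> d0.
(* Beyond [N], twice the bound of [step_dist] is at most [d]; the finitely many other [m] are
   handled by continuity. *)
have [N NP] : exists N : nat, forall m : int, (N < `|m|)%N ->
    4 * e / `|m|%N%:R <= d.
  exists (Num.truncn (4 * e / d)) => m Nm.
  have m0 : 0 < `|m|%N%:R :> R by rewrite ltr0n; lia.
  rewrite ler_pdivrMr// [d * _]mulrC -ler_pdivrMr//.
  apply: ltW; apply: lt_le_trans (truncnS_gt _) _.
  by rewrite ler_nat.
have fin : \forall y \near x, forall m : int, (`|m| <= N)%N ->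
    `|model m x - model m y| <= d.
  have one m : \forall y \near x, `|model m x - model m y| <= d.
    suff : {for x, continuous (model m)} by move=> /cvgrPdist_le; exact.
    apply: continuous_comp; last exact: continuous_step.
    apply: continuous_comp; last exact: tc.
    exact: continuous_ziter.
  elim: N {NP} => [|N IH].
    by apply: filterS (one 0) => y h m m0; have -> : m = 0 by lia.
  apply: filterS2 IH (filterI (one N.+1%:Z) (one (- N.+1%:Z))) => y h [hp hn] m mN.
  have [mN'|mN'] := leqP `|m| N; first exact: h.
  by have [->|->] : m = N.+1%:Z \/ m = - N.+1%:Z by lia.
apply: filterS fin => y h m; have [mN|Nm] := leqP `|m| N; first exact: h.
apply: le_trans (NP m Nm).
have m0 : m != 0 by apply/eqP; lia.
rewrite -(subrKA (saddle e)) (le_trans (ler_normD _ _))//.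
rewrite -[X in _ + X]normrN opprB.
have := step_dist e1 (tz m x) m0; have := step_dist e1 (tz m y) m0.
rewrite -/(model m x) -/(model m y).
rewrite (_ : 4 * e / `|m|%:R = 2 * e / `|m|%:R + 2 * e / `|m|%:R).
  by move=> h1 h2; exact: lerD.
by rewrite -mulrDl; congr (_ / _); ring.
Qed.

Lemma continuous_generator : continuous generator.
Proof.
move=> x; apply/cvgrPdist_le => d d0.
apply: filterS (model_equicontinuous x (d := d / 2) _); last by lra.
move=> y h; rewrite generatorB (le_trans (ler_normD _ _))//.
have := h (kappa x); have := h (kappa y).
case: ifP => _; rewrite ?normr0; lra.
Qed.

(** Going from [x] to [T x] advances the time of a passage by one. If time [kappa x + 1] is not
    active at [T x], both sides are the identity, even when another passage begins at [T x]. *)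
Lemma conjugator_next x :
  conjugator (T x) = frame e (kappa x + 1) (tz (kappa x) x).
Proof.
have tzT m : tz (m + 1) (T x) = tz m x.
  rewrite /tz -{1}[T x]/(ziter T Tinv 1 x) -ziterD//.
  by congr (t (ziter _ _ _ _)); lia.
have [px|npx] := pselect (passes (kappa x + 1) (T x)).
  by rewrite /conjugator (passes_kappa px) tzT.
have -> : frame e (kappa x + 1) (tz (kappa x) x) = 1%:M.
  rewrite -tzT; apply: frame_trivial; first exact: t_ge0.
  by rewrite leNgt; apply/negP.
set k := kappa (T x); rewrite /conjugator -/k.
have [kE|kN] := eqVneq k (kappa x + 1).
  apply: frame_trivial; first exact: t_ge0.
  by rewrite leNgt kE; apply/negP.
apply: (frame_next_trivial e1); first exact: t_ge0.
rewrite leNgt; apply/negP => h.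
have : passes (k - 1) x by rewrite /passes -tzT subrK.
by move=> /passes_kappa kx; rewrite kx subrK eqxx in kN.
Qed.


Lemma det_generator x : \det (generator x) = 1.
Proof. exact: det_step. Qed.

Let saddlen n := mx22 (e ^+ n) 0 0 (e^-1 ^+ n).

(** The relation [step_frame] telescopes along the orbit; [t] must be positive there, since the
    frames degenerate at [s = 0]. *)
Lemma cocycle_conjugator x n : (forall j, 0 < t (ziter T Tinv j x)) ->
  cocycle_nat T generator n x *m conjugator x =
  conjugator (iter n T x) *m saddlen n.
Proof.
move=> tpos; elim: n => [|n IH].
  by rewrite /saddlen !expr0 -mx22_1 mul1mx mulmx1.
rewrite [cocycle_nat _ _ _ _]/= -mulmxA IH mulmxA.
have -> : saddlen n.+1 = saddle e *m saddlen n.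
  by rewrite /saddlen /saddle mul_mx22 !exprS; apply: mx22_eq; ring.
rewrite mulmxA; congr (_ *m _); rewrite iterS.
move: (iter n T x) (erefl (ziter T Tinv n%:Z x) : iter n T x = _) => z zE.
rewrite conjugator_next /generator /conjugator.
apply: (step_frame e1); last exact: t_le1.
by rewrite /tz zE -ziterD.
Qed.

(** If [T^n x] is at time [k] of a passage, its centre is [T^(n-k) x], where [t] is at least
    [c / (|n - k| + 1)]. As [|n - k| + 1 <= (n + 2) * width k], [frame_norm] applies with
    [w = c / (n + 2)]. *)
Lemma conjugator_norm x (c : R) n : 0 < c -> c <= 1 ->
  (forall j : int, c <= t (ziter T Tinv j x) * (`|j|%N.+1)%:R) ->
  `|conjugator (iter n T x)| <= n.+2%:R / c.
Proof.
move=> c0 c1 tc'; rewrite -[n.+2%:R / c]invf_div.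
have n0 : 0 < n.+2%:R :> R by [].
apply: frame_norm => //; first by rewrite divr_gt0.
  by rewrite ler_pdivrMr// mul1r (le_trans c1)// ler1n.
set k := kappa _.
have -> : tz k (iter n T x) = t (ziter T Tinv (n%:Z - k) x).
  by rewrite /tz -[iter n T x]/(ziter T Tinv n%:Z x) -ziterD// addrC.
rewrite ler_pdivrMr// (le_trans (tc' (n%:Z - k)))// -mulrA ler_wpM2l//.
rewrite /width -natrM ler_nat.
have h1 : (1 <= maxn 1 `|k|)%N by rewrite leq_maxl.
have h2 : (`|k| <= maxn 1 `|k|)%N by rewrite leq_maxr.
have : (`|(n%:Z - k)%R|.+1 <= n + `|k| + 1)%N by lia.
by move: (maxn _ _) h1 h2 => w h1 h2 h3; nia.
Qed.

(* [A^(n)] and [D^n] differ by the factors [conjugator (T^n x)] and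
   [conjugator x], of at most linear size in [n]. *)
Lemma generator_growth x (c : R) n : 0 < c -> c <= 1 ->
  (forall j : int, c <= t (ziter T Tinv j x) * (`|j|%N.+1)%:R) ->
  let C := 16 / c ^+ 2 * n.+2%:R in
  let u := opnorm (cocycle_nat T generator n x) in
  u <= C * e ^+ n /\ e ^+ n <= C * u.
Proof.
move=> c0 c1 tc' C u.
have tpos j : 0 < t (ziter T Tinv j x).
  by have := lt_le_trans c0 (tc' j); rewrite pmulr_lgt0.
have e0 : 0 < e by exact: lt_le_trans e1.
have en1 : 1 <= e ^+ n by exact: exprn_ege1.
have hyn : `|saddlen n| <= e ^+ n.
  apply: mx22_norm_le; rewrite ?normr0 ?exprn_ge0 ?(ltW e0)//.
    by rewrite ger0_norm// exprn_ge0// ltW.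
  rewrite ger0_norm ?exprn_ge0 ?invr_ge0 ?(ltW e0)// exprVn.
  by apply: le_trans (en1); rewrite invf_le1 ?exprn_gt0.
have eh : e ^+ n <= `|saddlen n|.
  have := mx_norm_ge (saddlen n) 0 0; rewrite !mxE/= ger0_norm//.
  by rewrite exprn_ge0// ltW.
have N0 := @conjugator_norm x c 0 c0 c1 tc'.
have Nn := @conjugator_norm x c n c0 c1 tc'.
have rel := cocycle_conjugator n tpos.
have det_conj z : 0 < tz (kappa z) z -> \det (conjugator z) = 1.
  exact: det_frame.
have [|G [PG _ Gle]] := det1_inverse (M := conjugator x).
  by apply: det_conj; exact: tpos.
have [|H [_ HP Hle]] := det1_inverse (M := conjugator (iter n T x)).
  apply: det_conj; rewrite /tz -[iter n T x]/(ziter T Tinv n%:Z x) -ziterD//.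
have mul3 (M1 M2 M3 : 'M[R]_2) (a1 a2 a3 : R) : `|M1| <= a1 -> `|M2| <= a2 ->
    `|M3| <= a3 -> `|M1 *m M2 *m M3| <= 4 * (a1 * a2 * a3).
  move=> h1 h2 h3; apply: le_trans (mx_norm_mul _ _) _.
  have -> : 4 * (a1 * a2 * a3) = 2 * (2 * a1 * a2) * a3 by ring.
  apply: ler_pM => //.
  rewrite -[2 * a1 * a2]mulrA ler_pM2l//; apply: le_trans (mx_norm_mul _ _) _.
  by rewrite -!mulrA ler_pM2l//; apply: ler_pM.
set M := cocycle_nat T generator n x in rel *.
have ME : M = conjugator (iter n T x) *m saddlen n *m G.
  by rewrite -rel -mulmxA PG mulmx1.
have hE : saddlen n = H *m M *m conjugator x.
  by rewrite -mulmxA rel mulmxA HP mul1mx.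
have cc : c != 0 by rewrite gt_eqF.
split.
  apply: le_trans (opnorm_le _) _; rewrite -/M ME.
  (* The constant 16 collects 2 from [opnorm_le], 4 from the two matrix products and 2 from the
     bound [2 / c] on the conjugator at time 0. *)
  apply: le_trans (_ : 2 * (4 * (n.+2%:R / c * e ^+ n * (2 / c))) <= _).
    by rewrite ler_pM2l//; apply: mul3 => //; exact: le_trans N0.
  by rewrite le_eqVlt /C; apply/orP; left; apply/eqP; field.
apply: le_trans eh _; rewrite hE.
apply: le_trans (_ : 4 * (n.+2%:R / c * u * (2 / c)) <= _).
  by apply: mul3 => //; [exact: le_trans Nn|exact: opnorm_ge].
have u0 : 0 <= u by apply: le_trans (opnorm_ge M).
rewrite -subr_ge0 (_ : _ - _ = 8 / c ^+ 2 * n.+2%:R * u).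
  by rewrite !mulr_ge0// invr_ge0 sqr_ge0.
by rewrite /C; field.
Qed.

Lemma cocycle_natSr (A : X -> 'M[R]_2) n x :
  cocycle_nat T A n.+1 x = cocycle_nat T A n (T x) *m A x.
Proof.
elim: n => [|n IH]; first by rewrite /= mulmx1 mul1mx.
by rewrite [LHS]/= -/(cocycle_nat T A n.+1 x) IH mulmxA -iterS iterSr.
Qed.

(** As [t y = 0], the point [T^m y] is at time [m] of a passage with [s = 0], for every [m]. The
    induction adds one step at each end. *)
Lemma generator_swap y n : t y = 0 ->
  cocycle_nat T generator (2 * n).+1 (ziter T Tinv (- n%:Z) y) = swap e n.
Proof.
move=> ty; have gen m : generator (ziter T Tinv m y) = step e m 0.
  have tm : tz m (ziter T Tinv m y) = 0 by rewrite /tz -ziterD// addNr.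
  by rewrite (@generator_passes m) /model ?tm// /passes tm mul0r.
elim: n => [|n IH].
  by rewrite /= -[y in generator y]/(ziter T Tinv 0 y) gen !mulmx1 swap0.
rewrite (_ : (2 * n.+1).+1 = ((2 * n).+1).+2)%N; last by rewrite mulnS.
set z := ziter T Tinv _ y.
have zT : T z = ziter T Tinv (- n%:Z) y.
  by rewrite /z -ziterS//; congr (ziter _ _ _ _); lia.
have cS k x : cocycle_nat T generator k.+1 x =
  generator (iter k T x) *m cocycle_nat T generator k x by [].
rewrite cS cocycle_natSr iterSr zT IH.
rewrite -[iter _ _ _]/(ziter T Tinv (2 * n).+1%:Z _) -ziterD//.
have -> : (2 * n).+1%:Z - n%:Z = n.+1%:Z by lia.
by rewrite !gen mulmxA swapS.
Qed.

End Cocycle.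

(** * Growth rates: the exponent and the failure of uniform hyperbolicity *)

Lemma growth_squeeze (R : realType) (l C : R) (u : nat -> R) : 0 < C ->
  (forall n, u n <= C * n.+2%:R * expR l ^+ n /\
             expR l ^+ n <= C * n.+2%:R * u n) ->
  n%:R^-1 * ln (u n) @[n --> \oo] --> l.
Proof.
move=> C0 uP; apply/cvgrPdist_le => d d0.
have eE n : expR l ^+ n = expR (l * n%:R) by rewrite expRM_natr.
near=> n.
have n0 : 0 < n%:R :> R by rewrite ltr0n; near: n; exact: nbhs_infty_gt.
have Cn : C * n.+2%:R <= expR (d * n%:R).
  (* With [x = d * n] this gives [C * (n + 2) <= 3 * C * n <= x ^ 2 / 2 <= expR x]. *)
  have nC : 6 * C / d ^+ 2 <= n%:R by near: n; exact: nbhs_infty_ger.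
  have n1 : 1 <= n%:R :> R by rewrite ler1n -(ltr0n R).
  apply: le_trans (expR_ge1Dxn 1 _); last by rewrite mulr_ge0// ltW.
  rewrite ler_pdivrMr ?exprn_gt0// in nC.
  have -> : n.+2%:R = n%:R + 2 :> R by rewrite -natrD addn2.
  move: (n%:R : R) n0 n1 nC => a *.
  have : (6 * C) * a <= a * d ^+ 2 * a by rewrite ler_pM2r.
  have : C * 2 <= C * (2 * a) by rewrite ler_pM2l//; lra.
  by rewrite (_ : (2`!)%:R = 2)// exprMn; lra.
have [uu ul] := uP n; rewrite !eE in uu ul.
have Cn0 : 0 < C * n.+2%:R by rewrite mulr_gt0.
have u0 : 0 < u n.
  by have := lt_le_trans (expR_gt0 _) ul; rewrite pmulr_rgt0.
have up : ln (u n) <= (l + d) * n%:R.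
  rewrite -[leRHS]expRK ler_ln ?posrE ?expR_gt0//.
  rewrite mulrDl expRD mulrC (le_trans uu)// ler_pM2r ?expR_gt0//.
have lo : (l - d) * n%:R <= ln (u n).
  rewrite -[leLHS]expRK ler_ln ?posrE ?expR_gt0//.
  rewrite mulrBl expRD expRN ler_pdivrMr ?expR_gt0// (le_trans ul)// mulrC.
  by rewrite ler_pM2l.
rewrite distrC ler_distl mulrC; apply/andP; split.
- by rewrite ler_pdivlMr.
- by rewrite ler_pdivrMr.
Unshelve. all: by end_near. Qed.

(** A positive liminf bounds some tail of the infima below by a positive number, while at time
    [2 * n + 1] the infimum is at most a constant over [2 * n + 1]. *)
Lemma not_uniformly_hyperbolic (R : realType) (X : Type) (T Tinv : X -> X)
    (A : X -> 'M[R]_2) (C : R) :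
  (forall n, exists x, `|cocycle_nat T A (2 * n).+1 x| <= C) ->
  ~ uniformly_hyperbolic T Tinv A.
Proof.
move=> small [+ _]; set v := (fun n : nat => _).
rewrite limn_einf_lim (cvg_lim _ (@cvg_einfs_sup _ v))//.
move=> /ereal_sup_gt[_ [N _ <-]] vN.
have C0 : 0 <= C by have [x] := small 0%N; apply: le_trans.
have bound n : (N <= n)%N ->
    (einfs v N <= (ln (1 + 2 * C) / (2 * n).+1%:R)%:E)%E.
  move=> Nn; apply: (@le_trans _ _ (v (2 * n).+1)).
    by apply: ereal_inf_lbound; exists (2 * n).+1 => //=; lia.
  have [x xC] := small n.
  apply: (@le_trans _ _ (growth T Tinv A (2 * n).+1%:Z x)%:E).
    by apply: ereal_inf_lbound; exists x.
  rewrite lee_fin /growth mulrC ler_pM2r ?invr_gt0//.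
  (* [ln] is 0 at nonpositive arguments; the summand 1 in [1 + 2 * C] keeps the bound nonnegative
     there. *)
  have [u0|u0] := leP (opnorm (cocycle T Tinv A (2 * n).+1%:Z x)) 0.
    by rewrite ln0// ln_ge0//; lra.
  rewrite ler_ln ?posrE//; last by lra.
  by apply: le_trans (opnorm_le _) _; move: xC => /=; lra.
case: (einfs v N) vN bound => [r|_ /(_ N (leqnn N))|//]; last by [].
rewrite lte_fin => r0 bound.
pose n := (N + Num.truncn (ln (1 + 2 * C) / r))%N.
have := bound n (leq_addr _ _); rewrite lee_fin ler_pdivlMr//.
rewrite [r * _]mulrC -ler_pdivlMr// leNgt => /negP; apply.
apply: lt_le_trans (truncnS_gt _) _.
by rewrite ler_nat /n; move: (Num.truncn _) => k; lia.
Qed.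

Theorem theorem2p9 (R : realType) (X : pmetricType R) (T Tinv : X -> X)
    (L : set X) (lambda0 : R) :
  compact [set: X] ->
  homeomorphism T Tinv ->
  bilipschitz T ->
  compact L ->
  T @` L = L ->
  (exists x y, [/\ L x, L y & x <> y]) ->
  conjugate_to_mixing_sft T L ->
  0 < lambda0 ->
  exists A : X -> 'M[R]_2,
    [/\ continuous A,
        forall x, SLpm (A x),
        forall mu : probability (borel X) R,
          invariant_measure T mu -> ergodic T mu ->
          has_lyapunov_exponent T Tinv A mu lambda0
      & ~ uniformly_hyperbolic T Tinv A].
Proof.
move=> _ [TK KT Tc Tic] Tlip _ _ L2 Lsft l0.
have [y [c c0 yc]] := nonrecurrent_point TK KT L2 Lsft.
have [t [tc ty t01 t_sep]] := exists_return_gauge KT Tlip c0 yc.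
have e1 : 1 <= expR lambda0 by rewrite -expR0 ler_expR ltW.
exists (generator T Tinv t (expR lambda0)); split.
- exact: continuous_generator.
- by move=> x; left; exact: det_generator.
- move=> mu muT _.
  have aeF : Filter (almost_everywhere mu) := ae_filter_ringOfSetsType mu.
  apply: filterS (ae_slow_approach TK KT Tc Tic tc t01 t_sep muT).
  move=> x [b /andP[b0 b1] tb]; apply: (@growth_squeeze _ _ (16 / b ^+ 2)).
    by rewrite divr_gt0// exprn_gt0.
  by move=> n; exact: (generator_growth TK KT t01 t_sep e1 n b0 b1 tb).
- apply: (@not_uniformly_hyperbolic _ _ _ _ _ 2) => n.
  exists (ziter T Tinv (- n%:Z) y).
  by rewrite (generator_swap TK KT t01 t_sep e1 n ty); exact: swap_norm.
Qed.
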